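(* There exist a rational function $A(z)$ and a transcendental meromorphic function $f$ on $\mathbb{C}$ of order of growth $\rho(f)=1/2$ such that $$f(z+1)=\frac{f(z)+A(z)}{1-f(z)}$$ holds as an identity of meromorphic functions on $\mathbb{C}$.
   Context: A meromorphic function on $\mathbb{C}$ is transcendental if it is not a rational function. The order of growth of a meromorphic function $f$ on $\mathbb{C}$ is $\rho(f)=\limsup_{r\to\infty}\frac{\log T(r,f)}{\log r}$, where $T(r,f)$ is the Nevanlinna characteristic function of $f$. *)

(* Defs.v *)
From HB Require Import structures.
From mathcomp Require Import all_boot all_order all_algebra.
From mathcomp Require Import all_classical all_reals all_analysis.
From mathcomp Require Import complex.

Set Implicit Arguments.
Unset Strict Implicit.
Unset Printing Implicit Defensive.

Import Order.TTheory GRing.Theory Num.Theory numFieldNormedType.Exports.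

Local Open Scope classical_set_scope.
Local Open Scope ring_scope.
Local Open Scope complex_scope.

(* [(R[i])^o] is R[i] seen as a one-dimensional normed space over itself, so
   that [derivable] in direction 1 is complex differentiability. *)
Notation Cplx R := ((R[i])^o).

(* A meromorphic function is represented by a total function whose values on
   any closed discrete set (in particular at the poles) are irrelevant:
   apart from [holomorphic_near], applied to local witnesses only, every notion
   below depends on f only up to [meq]. *)
Section Meromorphic.
Context {R : realType}.
Local Notation C := (Cplx R).
Implicit Types (f g : C -> C) (z : C) (n : nat) (r t : R).

Definition meq f g := forall z0, \forall z \near z0^', f z = g z.

Definition holomorphic_near g z0 := \forall z \near z0, derivable g z 1.

Definition meromorphic f := forall z0, exists n g,
  holomorphic_near g z0 /\
  \forall z \near z0^', f z = g z / (z - z0) ^+ n.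

Definition rational_fun f := exists p q : {poly R[i]},
  q != 0 /\ meq f (fun z => p.[z] / q.[z]).

Definition transcendental f := ~ rational_fun f.

Definition pole_of_order f z0 n :=
  (0 < n)%N /\ exists g,
    [/\ holomorphic_near g z0, g z0 != 0 &
        \forall z \near z0^', f z = g z / (z - z0) ^+ n].

(* 0 when z0 is not a pole; a pole has exactly one order. *)
Definition pole_order f z0 : nat := xget 0%N [set n | pole_of_order f z0 n].

(* The norm of the numDomainType R[i] is R[i]-valued, hence the use of the
   R-valued modulus [normc]. *)
Local Notation modulus := ComplexField.Normc.normc.

Definition circle_point r t : C := (r * cos t) +i* (r * sin t).

(* log^+; recall that [ln] is 0 on nonpositive reals. *)
Definition lnp (x : R) : R := Num.max 0 (ln x).

Local Open Scope ereal_scope.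

(* m(r, f) *)
Definition proximity_fun f r : \bar R :=
  ((2 * pi)^-1)%:E *
  \int[lebesgue_measure]_(t in `[0%R, (2 * pi)%R])
    (lnp (modulus (f (circle_point r t))))%:E.

(* n(t, f) *)
Definition pole_count f t : \bar R :=
  \esum_(z in [set z : C | (modulus z <= t)%R]) (pole_order f z)%:R%:E.

(* N(r, f) *)
Definition counting_fun f r : \bar R :=
  \int[lebesgue_measure]_(t in `]0%R, r])
    ((pole_count f t - pole_count f 0) * (t^-1)%:E)
  + pole_count f 0 * (ln r)%:E.

(* T(r, f) *)
Definition nevanlinna_char f r : \bar R := proximity_fun f r + counting_fun f r.

Definition order_of_growth f : \bar R :=
  limf_esup (fun r : R => lne (nevanlinna_char f r) / (ln r)%:E) +oo%R.

End Meromorphic.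

(* Main.v *)
Require Import Defs.
From HB Require Import structures.
From mathcomp Require Import all_boot all_order all_algebra.
From mathcomp Require Import all_classical all_reals all_analysis.
From mathcomp Require Import measurable_realfun complex.
From mathcomp Require Import ring lra zify.

Set Implicit Arguments.
Unset Strict Implicit.
Unset Printing Implicit Defensive.

Import Order.TTheory GRing.Theory Num.Theory numFieldNormedType.Exports.

(** The Meixner polynomials
    Q_n(z) = sum_k C(n,k) binom(z,k) n^-k satisfy a three-term recurrence in n,
    whose energy identity forces their zeros to be real and negative, and, by
    the symmetry of the sum in n and z, a difference equation in z. Hence
    Q_n(z) = prod_j (1 + nu_j z) with nu_j > 0, and comparing with the explicit
    value at z = (j+1)^2 gives nu_j <= C/(j+1)^2 uniformly in n. Along an
    ultrafilter the Q_n converge to an entire function y with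
    (z+2) y(z+2) - 2 (z+2) y(z+1) + (z+1) y(z) = 0, and
    f(z) = 1 - y(z+1)/y(z) solves the Riccati equation with A(z) = -1/(z+2).

    Its poles are the points -1/nu_j, so n(r,f) <= sqrt(C r), and the product
    bounds log+ |f(r e^it)| by a constant plus a multiple of |sin t|^(-1/2),
    so m(r,f) = O(1). Conversely y(8 k^2) >= 2^k prevents
    nu_j = o(1/(j+1)^2), which gives N(r,f) >= b sqrt(r) for arbitrarily
    large r. *)

Local Open Scope ring_scope.

(** The substitution [f(z) = 1 - y(z+1)/y(z)] linearises the Riccati equation to
    [y(z+2) - 2 y(z+1) + (1 + A(z)) y(z) = 0]. With [A(z) = -1/(z+2)] the second difference of [y]
    is [y(z)/(z+2)], a discrete form of [y'' = y/z], whose solutions grow like [exp(2 sqrt z)];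
    hence the order 1/2. Since [C(n,k) n^-k] tends to [1/k!], the limit is formally
    [sum_k binom(z,k)/k!], the Laguerre function [L_z(-1)]. The series hides its zeros.
    Approximation by polynomials with negative zeros supplies a product with explicit bounds, and
    these yield the poles and both Nevanlinna terms by elementary estimates. Limits are needed at
    once for all values [Q_n(z)], all [nu_j], all derivatives and all products with finitely many
    factors deleted. An ultrafilter provides them together, without extracting subsequences.
    Convergence is only pointwise, so holomorphy and non-vanishing pass to the limit through
    inequalities uniform in [n]. *)

Local Notation nc := ComplexField.Normc.normc.
Local Notation Re := complex.Re.
Local Notation Im := complex.Im.
Local Notation "x %:C" := (real_complex _ x) : ring_scope.

(** * Generalized binomials and Meixner polynomials *)

Section GeneralizedBinomial.
Variable K : numFieldType.
Implicit Types (x z a : K) (k m n : nat).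

Definition gbin z k : K := (\prod_(i < k) (z - i%:R)) / k`!%:R.

Lemma gbin0 z : gbin z 0 = 1.
Proof. by rewrite /gbin big_ord0 fact0 divr1. Qed.

Lemma gbinS z k : k.+1%:R * gbin z k.+1 = (z - k%:R) * gbin z k.
Proof.
rewrite /gbin big_ord_recr /= factS natrM.
have h1 : (k.+1%:R : K) != 0 by rewrite pnatr_eq0.
have h2 : (k`!%:R : K) != 0 by rewrite pnatr_eq0 -lt0n fact_gt0.
by field; rewrite h2 nat1r h1.
Qed.

Lemma gbin_pascal z k : gbin (z + 1) k.+1 = gbin z k.+1 + gbin z k.
Proof.
have nz j : (j.+1%:R : K) != 0 by rewrite pnatr_eq0.
elim: k => [|k IH].
  by apply: (mulfI (nz 0)); rewrite mulrDr !gbinS !gbin0; ring.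
apply: (mulfI (nz k.+1)); rewrite mulrDr !gbinS.
rewrite {}IH; have -> : (z + 1 - k.+1%:R) * (gbin z k.+1 + gbin z k) =
    (z - k%:R) * gbin z k.+1 + (z - k%:R) * gbin z k by rewrite -natr1; ring.
by rewrite -gbinS -!natr1; ring.
Qed.

Lemma gbin_absorb z k : k.+1%:R * gbin (z + 1) k.+1 = (z + 1) * gbin z k.
Proof. by rewrite gbin_pascal mulrDr gbinS -(nat1r k); ring. Qed.

Lemma gbin_nat n k : gbin n%:R k = 'C(n, k)%:R.
Proof.
elim: n k => [|n IH] [|k]; rewrite ?gbin0 ?bin0 //.
  by rewrite /gbin big_ord_recl /= subr0 !mul0r bin0n.
by rewrite -addn1 natrD gbin_pascal !IH addn1 binS natrD.
Qed.

Lemma gbinN1 k : gbin (-1) k = (-1) ^+ k.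
Proof.
have nz j : (j.+1%:R : K) != 0 by rewrite pnatr_eq0.
elim: k => [|k IH]; first by rewrite gbin0.
apply: (mulfI (nz k)); rewrite gbinS IH exprS -(nat1r k).
by ring.
Qed.

(** Truncation of the hypergeometric series [2F1(-x, -z; 1; a)]. It is symmetric in [x] and [z], and
    exact once one of them is a natural number smaller than [m]. *)
Definition gbin_sum a m x z : K := \sum_(k < m) gbin x k * gbin z k * a ^+ k.

Lemma gbin_sumC a m x z : gbin_sum a m x z = gbin_sum a m z x.
Proof. by apply: eq_bigr => k _; rewrite (mulrC (gbin x k)). Qed.

(* The summands of the left-hand side telescope. *)
Lemma gbin_sum_rec a m x z :
  (x + 1) * (gbin_sum a m (x + 1) z - gbin_sum a m x z)
  - (1 - a) * x * (gbin_sum a m x z - gbin_sum a m (x - 1) z)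
  - a * z * gbin_sum a m x z = - (m%:R * a ^+ m * gbin z m * gbin x m.-1).
Proof.
elim: m => [|[|m] IH].
- by rewrite /gbin_sum !big_ord0; ring.
- have := gbinS z 0.
  by rewrite /gbin_sum !big_ord1 !gbin0 /= !mul1r !mulr1 subr0 => ->; ring.
have e : gbin_sum a m.+2 =2
    fun x z => gbin_sum a m.+1 x z + gbin x m.+1 * gbin z m.+1 * a ^+ m.+1.
  by move=> ? ?; rewrite /gbin_sum big_ord_recr.
rewrite !{}e.
set S1 := gbin_sum a m.+1 (x + 1) z in IH *.
set S := gbin_sum a m.+1 x z in IH *.
set S0 := gbin_sum a m.+1 (x - 1) z in IH *.
have -> : (m.+2%:R * a ^+ m.+2 * gbin z m.+2 * gbin x m.+2.-1) =
    a ^+ m.+2 * gbin x m.+1 * (m.+2%:R * gbin z m.+2).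
  by rewrite /=; ring.
rewrite gbinS (exprS a m.+1); set B := gbin z m.+1 in IH *.
set am := a ^+ m.+1 in IH *.
(* Absorption and Pascal's rule express the shifts of [x] by one through [gbin x m.+1] and
   [gbin x m] alone. *)
have p1 : (x + 1) * gbin (x + 1) m.+1 =
   (x + 1) * (gbin x m.+1) + m.+1%:R * (gbin x m.+1 + gbin x m).
  by rewrite -gbin_pascal gbin_absorb -mulrDr -gbin_pascal.
have p0 : x * gbin (x - 1) m.+1 = x * gbin x m.+1 - m.+1%:R * gbin x m.+1.
  rewrite -[in X in _ = X - _](subrK 1 x) -[in X in _ = _ - X](subrK 1 x).
  by rewrite gbin_absorb gbin_pascal subrK mulrDr addrK.
move: IH; rewrite /= => IH.
have -> : - ((a * am) * gbin x m.+1 * ((z - m.+1%:R) * B)) =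
  - (m.+1%:R * am * B * gbin x m) + (m.+1%:R * (gbin x m.+1 + gbin x m) * B * am
  - (1 - a) * (m.+1%:R * gbin x m.+1) * B * am - a * z * gbin x m.+1 * B * am).
  by ring.
rewrite -IH.
have -> : m.+1%:R * (gbin x m.+1 + gbin x m) =
    (x + 1) * gbin (x + 1) m.+1 - (x + 1) * gbin x m.+1.
  by rewrite p1; ring.
have -> : m.+1%:R * gbin x m.+1 = x * gbin x m.+1 - x * gbin (x - 1) m.+1.
  by rewrite p0; ring.
by ring.
Qed.

(** The Meixner polynomial [M_n(z; 1, c)] with [a = 1 - 1/c]. For [0 < a < 1] this means [c > 1],
    the regime where the zeros are negative. *)
Definition meixner a n z := gbin_sum a n.+1 n%:R z.

Lemma gbin_natl_small n k : (n < k)%N -> gbin n%:R k = 0.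
Proof. by move=> h; rewrite gbin_nat bin_small. Qed.

Lemma meixnerE a n m z : (n < m)%N -> gbin_sum a m n%:R z = meixner a n z.
Proof.
move=> nm; rewrite /meixner /gbin_sum -(big_mkord xpredT
  (fun k => gbin n%:R k * gbin z k * a ^+ k)) (big_cat_nat (n := n.+1)) //=.
rewrite big_mkord [X in _ + X = _]big_nat [X in _ + X = _]big1 ?addr0 // => i /andP[ni _].
by rewrite gbin_natl_small // !mul0r.
Qed.

Lemma meixner0 a n : meixner a n 0 = 1.
Proof.
rewrite /meixner /gbin_sum big_ord_recl /= !gbin0 expr0 !mulr1 big1 ?addr0 //.
by move=> i _; rewrite (gbin_natl_small (n := 0)) // mulr0 mul0r.
Qed.

Lemma meixner_n0 a z : meixner a 0 z = 1.
Proof. by rewrite /meixner /gbin_sum big_ord1 !gbin0 expr0 !mulr1. Qed.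

(** In [gbin_sum_rec] at [x = n], [m = n.+2], the boundary term contains [gbin n%:R n.+1 = 0]. For
    [n = 0] the value at [n.-1] is multiplied by zero. *)
Lemma meixner_rec a n z :
  n.+1%:R * (meixner a n.+1 z - meixner a n z)
  = (1 - a) * n%:R * (meixner a n z - meixner a n.-1 z) + a * z * meixner a n z.
Proof.
have := gbin_sum_rec a n.+2 n%:R z.
rewrite /= (gbin_natl_small (ltnSn n)) mulr0 oppr0 -natr1.
rewrite natr1 !meixnerE // => /eqP; rewrite subr_eq0 subr_eq addrC => /eqP ->.
rewrite addrC; congr (_ + _); case: n => [|n]; first by rewrite mulr0n !mulr0 !mul0r.
by congr (_ * (_ - _)); rewrite -natr1 addrK meixnerE // leqW.
Qed.

(** The same relation with the degree as second argument of the symmetric sum, so that the shifts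
    act on [z]. *)
Lemma meixner_diff a n z :
  (z + 1) * (meixner a n (z + 1) - meixner a n z)
  = (1 - a) * z * (meixner a n z - meixner a n (z - 1))
    + a * n%:R * meixner a n z.
Proof.
have := gbin_sum_rec a n.+1 z n%:R.
rewrite (gbin_natl_small (ltnSn n)) mulr0 mul0r oppr0.
rewrite !(gbin_sumC _ _ _ n%:R) => /eqP.
by rewrite subr_eq0 subr_eq => /eqP ->; rewrite addrC.
Qed.

Lemma meixnerN1 a n : meixner a n (-1) = (1 - a) ^+ n.
Proof.
rewrite exprBn /meixner /gbin_sum; apply: eq_bigr => i _.
rewrite gbinN1 gbin_nat expr1n mulr1 -mulr_natr; ring.
Qed.

End GeneralizedBinomial.


(** * The real-valued modulus *)

Section ComplexModulus.
Variable R : realType.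
Implicit Types (x y : R[i]) (a b : R).

Lemma normrE x : `|x| = (nc x)%:C. Proof. by []. Qed.

Lemma nc_ge0 x : 0 <= nc x. Proof. by case: x => a b; rewrite sqrtr_ge0. Qed.

Lemma nc_real a : nc a%:C = `|a|.
Proof. by rewrite /= expr0n addr0 sqrtr_sqr. Qed.

Lemma ncM x y : nc (x * y) = nc x * nc y.
Proof. exact: ComplexField.Normc.normcM. Qed.

Lemma ncV x : nc x^-1 = (nc x)^-1.
Proof. exact: ComplexField.Normc.normcV. Qed.

Lemma ncD x y : nc (x + y) <= nc x + nc y.
Proof. by rewrite -lecR rmorphD -!normrE ler_normD. Qed.

Lemma ncN x : nc (- x) = nc x.
Proof. by apply: complexI; rewrite -!normrE normrN. Qed.

Lemma ncB x y : nc (x - y) <= nc x + nc y.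
Proof. by rewrite -(ncN y) ncD. Qed.

Lemma nc_sub_le x y : nc x - nc y <= nc (x - y).
Proof. by rewrite lerBlDr -{1}(subrK y x) ncD. Qed.

Lemma nc1 : nc (1 : R[i]) = 1.
Proof. by apply: complexI; rewrite -normrE normr1. Qed.

Lemma nc0 : nc (0 : R[i]) = 0.
Proof. by apply: complexI; rewrite -normrE normr0. Qed.

Lemma nc_eq0 x : (nc x == 0) = (x == 0).
Proof. by rewrite -(normr_eq0 x) normrE -(inj_eq (@complexI R)). Qed.

Lemma nc_gt0 x : (0 < nc x) = (x != 0).
Proof. by rewrite lt_def nc_eq0 nc_ge0 andbT. Qed.

Lemma nc_sqr x : nc x ^+ 2 = Re x ^+ 2 + Im x ^+ 2.
Proof. by case: x => a b; rewrite /= sqr_sqrtr // addr_ge0 // sqr_ge0. Qed.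

Lemma mulc_conj x : x * x^*%C = (nc x ^+ 2)%:C.
Proof. by rewrite -sqr_normc rmorphXn. Qed.

Lemma normRe_le x : `|Re x| <= nc x.
Proof. by rewrite -lecR -normrE normc_ge_Re. Qed.

Lemma normIm_le x : `|Im x| <= nc x.
Proof. by case: x => a b /=; rewrite -sqrtr_sqr ler_sqrt ?lerDr ?addr_ge0 ?sqr_ge0. Qed.

Lemma nc_le x : nc x <= `|Re x| + `|Im x|.
Proof.
rewrite -(@ler_pXn2r _ 2) ?nnegrE ?nc_ge0 ?addr_ge0 //.
rewrite nc_sqr sqrrD !real_normK ?num_real // addrAC lerDl.
by rewrite mulrn_wge0 ?mulr_ge0.
Qed.

Lemma nc_prod (I : Type) (r : seq I) (P : pred I) (F : I -> R[i]) :
  nc (\prod_(i <- r | P i) F i) = \prod_(i <- r | P i) nc (F i).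
Proof. by apply: (big_morph _ ncM nc1). Qed.

Lemma realC_eq0 a : (a%:C == 0 :> R[i]) = (a == 0).
Proof. by rewrite -(inj_eq (@complexI R)). Qed.

Lemma ncX x n : nc (x ^+ n) = nc x ^+ n.
Proof. by apply: complexI; rewrite rmorphXn -!normrE normrX. Qed.

End ComplexModulus.

(** * The zeros of the Meixner polynomials are negative reals *)

Section MeixnerRoots.
Variables (R : realType) (a : R).
Hypotheses (a_gt0 : 0 < a) (a_lt1 : a < 1).
Implicit Types (z : R[i]) (n k : nat).

Local Notation Q := (meixner a%:C).
Local Notation w k := ((1 - a) ^- k).

(* Summation by parts in the three-term recurrence in [n]. *)
Lemma meixner_energy n z :
  (Q n.+1 z)^*%C * ((w n * n.+1%:R)%:C * (Q n.+1 z - Q n z)) =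
  (\sum_(k < n.+1) w k * a * nc (Q k z) ^+ 2)%:C * z +
  (\sum_(k < n.+1) w k * k.+1%:R * nc (Q k.+1 z - Q k z) ^+ 2)%:C.
Proof.
have b0 : 1 - a != 0 by rewrite subr_eq0 eq_sym lt_eqF.
have dec k : (Q k.+1 z)^*%C * ((w k * k.+1%:R)%:C * (Q k.+1 z - Q k z)) =
    (w k * k.+1%:R * nc (Q k.+1 z - Q k z) ^+ 2)%:C +
    (Q k z)^*%C * ((w k * k.+1%:R)%:C * (Q k.+1 z - Q k z)).
  by rewrite [X in _ = X + _]rmorphM /= -mulc_conj rmorphB /=; ring.
(* The weight [w k = (1-a)^-k] makes the recurrence self-adjoint: as [w k * (1-a) = w k.-1] for
   [k > 0], the first term on the right is the left-hand side at [k.-1]. *)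
have e k : (w k * k.+1%:R)%:C * (Q k.+1 z - Q k z) =
    (w k)%:C * ((1 - a) * k%:R)%:C * (Q k z - Q k.-1 z) +
    (w k * a)%:C * z * Q k z.
  have := meixner_rec a%:C k z; rewrite !rmorphM /= !rmorph_nat rmorphB rmorph1.
  by rewrite -!mulrA => ->; ring.
elim: n => [|n IH].
  rewrite dec e !big_ord1 meixner_n0 rmorph1 mulr0 rmorph0 !(mulr0, mul0r).
  by rewrite add0r expr0 invr1 !mul1r nc1 expr1n rmorph1 mul1r !mulr1 addrC.
have e' : (Q n.+1 z)^*%C * ((w n.+1 * n.+2%:R)%:C * (Q n.+2 z - Q n.+1 z)) =
    (Q n.+1 z)^*%C * ((w n * n.+1%:R)%:C * (Q n.+1 z - Q n z)) +
    (Q n.+1 z)^*%C * ((w n.+1 * a)%:C * z * Q n.+1 z).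
  rewrite e mulrDr; congr (_ * (_ * _) + _); rewrite -rmorphM; congr (_%:C).
  by rewrite exprS; field; rewrite expf_neq0.
rewrite dec e' IH [in RHS]big_ord_recr [X in _ = _ + X%:C]big_ord_recr /=.
have -> : (Q n.+1 z)^*%C * ((w n.+1 * a)%:C * z * Q n.+1 z) =
    (w n.+1 * a * nc (Q n.+1 z) ^+ 2)%:C * z.
  by rewrite [in RHS]rmorphM /= -mulc_conj; ring.
by rewrite !rmorphD mulrDl; ring.
Qed.

(** At a zero the left-hand side of the energy identity vanishes and leaves [P z + S = 0] with real
    [P > 0] (its [k = 0] term is positive) and [S >= 0]. The value 1 at the origin excludes
    [S = 0]. *)
Lemma meixner_root n z : Q n z = 0 -> exists2 t : R, 0 < t & z = (- t)%:C.
Proof.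
case: n => [|n]; first by rewrite meixner_n0 => /eqP; rewrite oner_eq0.
move=> Q0; have := meixner_energy n z; rewrite Q0 rmorph0 mul0r.
set P := \sum_(k < _) _; set S := \sum_(k < _) _.
have w0 k : 0 < w k by rewrite invr_gt0 exprn_gt0 // subr_gt0.
have P0 : 0 < P.
  rewrite /P big_ord_recl ltr_pwDl //.
    by rewrite meixner_n0 nc1 !mulr_gt0 // expr1n.
  by apply: sumr_ge0 => k _; rewrite !mulr_ge0 ?exprn_ge0 ?nc_ge0 ?ltW.
have S0 : 0 <= S.
  by apply: sumr_ge0 => k _; rewrite !mulr_ge0 ?exprn_ge0 ?nc_ge0 ?ltW.
move=> /esym/eqP; rewrite addr_eq0 => /eqP e.
have ez : z = (- (S / P))%:C.
  have P1 : P%:C != 0 by rewrite realC_eq0 gt_eqF.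
  by apply: (mulfI P1); rewrite e -rmorphM -rmorphN; congr (_%:C); field; rewrite gt_eqF.
exists (S / P) => //; rewrite lt_def divr_ge0 ?(ltW P0) // andbT.
apply/eqP => SP; move: Q0; rewrite ez SP oppr0 meixner0 => /eqP.
by rewrite oner_eq0.
Qed.

Lemma meixner_poly n : exists2 p : {poly R[i]}, (size p <= n.+1)%N &
  forall z, p.[z] = Q n z.
Proof.
exists (\sum_(k < n.+1) (gbin n%:R k * a%:C ^+ k / k`!%:R) *:
    \prod_(i < k) ('X - i%:R%:P)).
  rewrite (leq_trans (size_sum _ _ _)) //; apply/bigmax_leqP => k _.
  rewrite (leq_trans (size_scale_leq _ _)) // size_prod_XsubC.
  by rewrite /index_enum unlock -enumT size_enum_ord.
move=> z; rewrite horner_sum; apply: eq_bigr => k _.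
rewrite hornerZ horner_prod /gbin; under eq_bigr do rewrite hornerXsubC.
by ring.
Qed.

Lemma meixner_factor n : exists s : seq R,
  [/\ (size s <= n)%N, sorted >=%R s, {in s, forall x, 0 < x} &
      forall z, Q n z = \prod_(j < n) (1 + (s`_j)%:C * z)].
Proof.
have [p sp ep] := meixner_poly n.
have p0 : p != 0.
  by apply/eqP => p0; have := ep 0; rewrite p0 horner0 meixner0 => /esym/eqP; rewrite oner_eq0.
have [r er] := closed_field_poly_normal p.
have rR x : x \in r -> exists2 t : R, 0 < t & x = (- t)%:C.
  move=> xr; apply: (@meixner_root n); rewrite -ep er hornerZ horner_prod.
  by rewrite (big_rem _ xr) /= hornerXsubC subrr mul0r mulr0.
pose s := sort >=%R [seq - (Re x)^-1 | x <- r].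
have ss : (size s <= n)%N.
  rewrite size_sort size_map -ltnS (leq_trans _ sp) // er size_scale ?size_prod_XsubC //.
  by rewrite lead_coef_eq0.
have s0 : {in s, forall x, 0 < x}.
  move=> x; rewrite mem_sort => /mapP[y /rR [t t0 ->] ->] /=.
  by rewrite invrN opprK invr_gt0.
exists s; split=> // [|z].
  by apply: sort_sorted => x y; rewrite le_total.
have -> : \prod_(j < n) (1 + (s`_j)%:C * z) = \prod_(x <- s) (1 + x%:C * z).
  rewrite (big_nth 0) -(big_mkord xpredT (fun j => 1 + (s`_j)%:C * z)).
  rewrite (big_cat_nat (n := size s)) //= [X in _ * X]big_nat.
  rewrite [X in _ * X]big1 ?mulr1 // => i /andP[si _].
  by rewrite nth_default // rmorph0 mul0r addr0.
rewrite (perm_big _ (permEl (perm_sort _ _))) big_map.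
have := ep 0; rewrite meixner0 er hornerZ horner_prod => e1.
(* Dividing by the value 1 at the origin cancels the leading coefficient: each factor becomes
   [(z - x)/(0 - x) = 1 - z/x]. *)
rewrite -ep er hornerZ horner_prod -[LHS]divr1 -{2}e1.
have l0 : lead_coef p != 0 by rewrite lead_coef_eq0.
rewrite -mulf_div divff // mul1r -prodf_div big_seq [RHS]big_seq.
apply: eq_bigr => x /rR[t t0 ->]; rewrite !hornerXsubC /=.
have t1 : t%:C != 0 by rewrite realC_eq0 gt_eqF.
rewrite invrN opprK fmorphV rmorphN.
by field.
Qed.

End MeixnerRoots.


(** * Size of the Meixner polynomials at integers *)

Lemma ffact_leX n k : (n ^_ k <= n ^ k)%N.
Proof.
elim: k => [|k IH]; first by rewrite ffactn0 expn0.
by rewrite ffactnSr expnSr leq_mul // leq_subr.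
Qed.

Lemma ffact_geX n k : ((n - k) ^ k <= n ^_ k)%N.
Proof.
elim: k => [|k IH]; first by rewrite ffactn0 expn0.
rewrite ffactnSr expnSr leq_mul //; last by rewrite leq_sub2l.
by rewrite (leq_trans _ IH) //; case: k {IH} => // k; rewrite leq_exp2r // leq_sub2l.
Qed.

Section ExponentialPartialSums.
Variable R : realType.
Implicit Types x : R.

Lemma expR_partial_sum_le x n : 0 <= x -> \sum_(k < n) x ^+ k / k`!%:R <= expR x.
Proof.
move=> x0; have := @nondecreasing_cvgn_le R (series (exp_coeff x)).
rewrite -(big_mkord xpredT (fun k => x ^+ k / k`!%:R)) => /(_ _ _ n); apply.
  apply/nondecreasing_seqP => k; rewrite seriesSr lerDl.
  exact: exp_coeff_ge0.
exact: is_cvg_series_exp_coeff.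
Qed.

Lemma sumr_sqr_le (F : nat -> R) n : (forall k, 0 <= F k) ->
  \sum_(k < n) F k ^+ 2 <= (\sum_(k < n) F k) ^+ 2.
Proof.
move=> F0; elim: n => [|n IH]; first by rewrite !big_ord0 expr0n.
rewrite !big_ord_recr /= sqrrD -addrA; apply: lerD IH _.
by rewrite lerDr mulrn_wge0 // mulr_ge0 // sumr_ge0.
Qed.

Lemma expn_div_fact_le n : n%:R ^+ n / n`!%:R <= expR n%:R :> R.
Proof.
apply: le_trans (expR_partial_sum_le n.+1 (ler0n R n)).
rewrite big_ord_recr /= lerDr; apply: sumr_ge0 => i _.
by rewrite divr_ge0 ?exprn_ge0.
Qed.

End ExponentialPartialSums.

Section MeixnerValues.
Variable R : realType.

Definition meixner_real n m : R :=
  \sum_(k < n.+1) 'C(n, k)%:R * 'C(m, k)%:R * n%:R ^- k.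

Lemma meixner_natE n m :
  meixner (n%:R^-1)%:C n m%:R = (meixner_real n m)%:C :> R[i].
Proof.
rewrite /meixner /gbin_sum /meixner_real rmorph_sum; apply: eq_bigr => k _.
by rewrite !gbin_nat -exprVn !rmorphM rmorphXn /= !rmorph_nat.
Qed.

(** From [C(n,k) n^-k <= 1/k!] and [C(s^2,k) <= s^(2k)/k!], each term is at most [(s^k/k!)^2]. A sum
    of squares is at most the square of the sum, here at most [(e^s)^2]. *)
Lemma meixner_real_le n s : (0 < n)%N -> meixner_real n (s ^ 2) <= expR 2 ^+ s.
Proof.
move=> n0; rewrite -expRM_natr mulrC [s%:R * 2]mulrC expRM_natl.
have s0 : 0 <= s%:R :> R by [].
apply: le_trans (_ : (\sum_(k < n.+1) s%:R ^+ k / k`!%:R) ^+ 2 <= _); last first.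
  rewrite ler_pXn2r ?nnegrE ?expR_ge0 ?expR_partial_sum_le //.
  by apply: sumr_ge0 => k _; rewrite divr_ge0 ?exprn_ge0.
have F0 k : 0 <= s%:R ^+ k / k`!%:R :> R by rewrite divr_ge0 ?exprn_ge0.
apply: le_trans (sumr_sqr_le n.+1 F0).
apply: ler_sum => k _.
have f0 : 0 < (k`!%:R : R) by rewrite ltr0n fact_gt0.
have n1 : 0 < (n%:R : R) by rewrite ltr0n.
rewrite expr_div_n -exprM [(k * 2)%N]mulnC exprM expr2 (mulrC 'C(n, k)%:R).
have b m : 'C(m, k)%:R <= m%:R ^+ k / k`!%:R :> R.
  by rewrite ler_pdivlMr // -natrM bin_ffact -natrX ler_nat ffact_leX.
rewrite -mulrA; apply: le_trans (_ : (s ^ 2)%:R ^+ k / k`!%:R * (n%:R ^+ k / k`!%:R / n%:R ^+ k) <= _).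
  by rewrite ler_pM ?mulr_ge0 ?invr_ge0 ?exprn_ge0 // ler_pM2r ?invr_gt0 ?exprn_gt0.
rewrite natrX expr2 le_eqVlt; apply/orP; left; apply/eqP; field.
by rewrite !gt_eqF // exprn_gt0.
Qed.

(** The [k]-th term suffices. By [C(j,k) >= (j/2)^k/k!] for [j >= 2k], it is at least
    [(2 k^2)^k/(k!)^2], and [k! <= k^k]. The 8 pays for the two halvings and leaves the base 2. *)
Lemma meixner_real_ge n k : (k.*2 <= n)%N -> 2 ^+ k <= meixner_real n (8 * k ^ 2).
Proof.
case: k => [|k] kn.
  by rewrite /meixner_real big_ord_recl /= !bin0 expr0 invr1 !mulr1 lerDl sumr_ge0.
set m := (8 * _)%N; have km : (k.+1.*2 <= m)%N by rewrite /m; nia.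
have kn1 : (k.+1 < n.+1)%N by lia.
rewrite /meixner_real (bigD1 (Ordinal kn1)) //= -[leLHS]addr0 lerD //; last first.
  by apply: sumr_ge0 => i _; rewrite !mulr_ge0 // invr_ge0 exprn_ge0.
have f0 : 0 < (k.+1`!%:R : R) by rewrite ltr0n fact_gt0.
have n1 : 0 < (n%:R : R) by rewrite ltr0n; lia.
have b j : (k.+1.*2 <= j)%N -> (j%:R / 2) ^+ k.+1 / k.+1`!%:R <= 'C(j, k.+1)%:R :> R.
  move=> kj; rewrite ler_pdivrMr // -natrM bin_ffact.
  apply: le_trans (_ : ((j - k.+1) ^ k.+1)%:R <= _); last by rewrite ler_nat ffact_geX.
  rewrite natrX ler_pXn2r ?nnegrE ?divr_ge0 // natrB; last by lia.
  have : (k.+1.*2%:R <= j%:R :> R) by rewrite ler_nat.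
  rewrite -muln2 natrM; lra.
rewrite ler_pdivlMr ?exprn_gt0 //.
apply: le_trans (_ : (n%:R / 2) ^+ k.+1 / k.+1`!%:R * ((m%:R / 2) ^+ k.+1 / k.+1`!%:R) <= _);
  last by rewrite ler_pM ?b // divr_ge0 ?exprn_ge0 ?divr_ge0.
have -> : m%:R / 2 = 4 * k.+1%:R ^+ 2 :> R by rewrite /m natrM natrX; field.
rewrite mulf_div ler_pdivlMr ?mulr_gt0 // exprMn exprVn exprMn.
have f1 : k.+1`!%:R <= k.+1%:R ^+ k.+1 :> R.
  by rewrite -natrX ler_nat -ffactnn ffact_leX.
have -> : (4 : R) = 2 * 2 by ring.
rewrite exprMn -exprM mulnC exprM expr2.
have t0 : 0 < (2 : R) ^+ k.+1 by rewrite exprn_gt0.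
set t := 2 ^+ k.+1 in t0 *; set u := n%:R ^+ k.+1; set f := k.+1`!%:R in f0 f1 *; set v := k.+1%:R ^+ k.+1 in f1 *.
have u0 : 0 < u by rewrite exprn_gt0.
have -> : u / t * (t * t * (v * v)) = t * u * (v * v) by field; rewrite gt_eqF.
by rewrite ler_pM2l ?mulr_gt0 // ler_pM // ltW.
Qed.

End MeixnerValues.

Local Open Scope classical_set_scope.

(** * Uniform decay of the reciprocal zeros *)

Lemma sum_inv_sqr_le (R : realType) m n :
  \sum_(m <= j < n) (j.+1%:R ^- 2 : R) <= 2 / m.+1%:R.
Proof.
(* The extra term makes the induction telescope: [1/x^2 <= 2/x - 2/(x+1)] for [x >= 1]. *)
suff h k : \sum_(m <= j < m + k) (j.+1%:R ^- 2 : R) <= 2 / m.+1%:R - 2 / (m + k).+1%:R.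
  have [mn|nm] := leqP m n; last by rewrite big_geq ?divr_ge0 // ltnW.
  rewrite -(subnKC mn); apply: le_trans (h _) _.
  by rewrite lerBlDr lerDl divr_ge0.
elim: k => [|k IH]; first by rewrite addn0 big_geq // subrr.
rewrite addnS big_nat_recr ?leq_addr //=.
set j := (m + k)%N in IH *.
apply: le_trans (lerD IH (lexx _)) _; rewrite -addrA lerD2l.
have e : j.+2%:R = j.+1%:R + 1 :> R by rewrite natr1.
have j0 : 1 <= j.+1%:R :> R by rewrite ler1n.
rewrite e; set x := j.+1%:R in j0 *.
rewrite -subr_ge0.
have -> : - (2 / (x + 1)) - (- (2 / x) + x ^- 2) = (x - 1) / (x ^+ 2 * (x + 1)).
  by field; lra.
by rewrite divr_ge0 ?mulr_ge0 ?sqr_ge0; lra.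
Qed.

Section MeixnerZeros.
Variable R : realType.

(** At [z = (j+1)^2] the first [j+1] factors are each at least [1 + nu_j (j+1)^2] by monotonicity,
    the others at least 1, and the product is at most [e^(2(j+1))]. A [(j+1)]-th root gives
    [c = e^2] for every [N]. Degrees start at 2 so that [a = 1/(N+2) < 1]. *)
Lemma meixner_zeros : exists (nu : nat -> nat -> R) (c : R), 0 < c /\
  [/\ forall N j, 0 <= nu N j <= c / j.+1%:R ^+ 2,
      forall N i j, (i <= j)%N -> nu N j <= nu N i &
      forall N z, meixner (N.+2%:R^-1)%:C N.+2 z =
        \prod_(j < N.+2) (1 + (nu N j)%:C * z)].
Proof.
have H N : exists s : seq R, [/\ (size s <= N.+2)%N, sorted >=%R s, {in s, forall x, 0 < x} &
      forall z, meixner (N.+2%:R^-1)%:C N.+2 z = \prod_(j < N.+2) (1 + (s`_j)%:C * z)].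
  by apply: meixner_factor; rewrite ?invr_gt0 // invf_lt1 // ltr1n.
have [s sP] := choice H.
have ge0 N j : 0 <= (s N)`_j.
  have [_ _ s0 _] := sP N.
  have [js|js] := ltnP j (size (s N)); last by rewrite nth_default.
  by rewrite ltW // s0 // mem_nth.
have mono N i j : (i <= j)%N -> (s N)`_j <= (s N)`_i.
  move=> ij; have [_ so _ _] := sP N.
  have [js|js] := ltnP j (size (s N)); last by rewrite (nth_default _ js) ge0.
  apply: (sorted_leq_nth (rev_trans le_trans) (@lexx _ R)) => //.
  by rewrite inE (leq_ltn_trans ij).
exists (fun N j => (s N)`_j), (expR 2); split; first exact: expR_gt0.
split=> // [N j|N z]; last by have [_ _ _] := sP N; apply.
rewrite ge0 /= ler_pdivlMr ?exprn_gt0 //.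
have [ss _ _ pe] := sP N.
have [js|js] := ltnP j (size (s N)); last by rewrite nth_default // mul0r expR_ge0.
have jN : (j.+1 <= N.+2)%N by rewrite (leq_trans js).
have := meixner_real_le R j.+1 (ltn0Sn N.+1).
have -> : meixner_real R N.+2 (j.+1 ^ 2) = \prod_(i < N.+2) (1 + (s N)`_i * j.+1%:R ^+ 2).
  apply: complexI; rewrite -meixner_natE pe rmorph_prod; apply: eq_bigr => i _.
  by rewrite rmorphD rmorphM /= rmorph1 rmorphXn /= rmorph_nat natrX.
rewrite -(big_mkord xpredT (fun i => 1 + (s N)`_i * j.+1%:R ^+ 2)).
rewrite (big_cat_nat (n := j.+1)) //= => h.
have {h} : (1 + (s N)`_j * j.+1%:R ^+ 2) ^+ j.+1 <= expR 2 ^+ j.+1.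
  apply: le_trans h; rewrite -[leLHS]mulr1 ler_pM //.
  - by rewrite exprn_ge0 // addr_ge0 // mulr_ge0 ?sqr_ge0.
  - rewrite (_ : _ ^+ _ = \prod_(0 <= i < j.+1) (1 + (s N)`_j * j.+1%:R ^+ 2));
      last by rewrite prodr_const_nat subn0.
    rewrite !big_nat; apply: ler_prod => i /andP[_ ij].
    rewrite addr_ge0 ?mulr_ge0 ?sqr_ge0 //= lerD2l ler_wpM2r ?sqr_ge0 // mono //.
  - rewrite [leLHS](_ : _ = \prod_(j.+1 <= i < N.+2) 1); last by rewrite big1_eq.
    by apply: ler_prod => i _; rewrite ler01 lerDl mulr_ge0 ?sqr_ge0.
rewrite ler_pXn2r ?nnegrE ?expR_ge0 ?addr_ge0 ?mulr_ge0 ?sqr_ge0 // => h.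
by apply: le_trans h; rewrite lerDr.
Qed.

End MeixnerZeros.

(** * Limits along an ultrafilter *)

Section UltraLimits.
Variable R : realType.
Variable U : set_system nat.
Hypothesis UU : UltraFilter U.
Implicit Types (u v : nat -> Cplx R) (l : Cplx R).

(** Compactness gives a cluster point, and an ultrafilter converges to its cluster points, since it
    contains each set or its complement. *)
Lemma real_ultra_cvg (u : nat -> R) (B : R) : (forall n, `|u n| <= B) ->
  exists p : R, u n @[n --> U] --> p.
Proof.
move=> uB; have cK := @segment_compact R (- B) B.
have [|p [_ pP]] := cK (u @ U) _.
  by rewrite /=; apply: filterS filterT => n _; rewrite /= in_itv /= -ler_norml.
exists p => V pV.
have [//|nV] := in_ultra_setVsetC (u @^-1` V) UU.
by have [x []] := pP (~` V) V nV pV.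
Qed.

Lemma complex_cvg (F : set_system nat) (FF : Filter F) u l :
  Re (u n) @[n --> F] --> Re l -> Im (u n) @[n --> F] --> Im l ->
  u n @[n --> F] --> l.
Proof.
move=> /cvgrPdist_lt hRe /cvgrPdist_lt hIm.
apply/cvgrPdist_lt => e e0.
(* A positive element for the order of [R[i]] has zero imaginary part. *)
have ee : e = (Re e)%:C.
  by move: e0; case: e => a b; rewrite ltcE /= => /andP[/eqP -> _].
have e1 : 0 < Re e / 2 by rewrite divr_gt0 //; move: e0; rewrite ltcE => /andP[].
near=> n; rewrite ee normrE ltcR; apply: le_lt_trans (nc_le _) _.
have -> : Re e = Re e / 2 + Re e / 2 by field.
apply: ltrD.
  by rewrite raddfB; near: n; apply: hRe.
by rewrite raddfB; near: n; apply: hIm.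
Unshelve. all: by end_near. Qed.

Lemma complex_ultra_cvg u B : (forall n, nc (u n) <= B) ->
  exists l, u n @[n --> U] --> l.
Proof.
move=> uB.
have [a ha] := @real_ultra_cvg (fun n => Re (u n)) B (fun n => le_trans (normRe_le _) (uB n)).
have [b hb] := @real_ultra_cvg (fun n => Im (u n)) B (fun n => le_trans (normIm_le _) (uB n)).
by exists (a +i* b)%C; apply: complex_cvg.
Qed.

Lemma cvg_nc (T : Type) (F : set_system T) (FF : Filter F) (f : T -> Cplx R) l :
  f x @[x --> F] --> l -> nc (f x) @[x --> F] --> nc l.
Proof.
move=> /cvgrPdist_lt h; apply/cvgrPdist_lt => e e0.
have := h e%:C; rewrite -(rmorph0 (real_complex R)) ltcR => /(_ e0).
apply: filterS => x; rewrite normrE ltcR; apply: le_lt_trans.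
rewrite ler_norml lerNl opprB; apply/andP; split; last exact: nc_sub_le.
by rewrite -(ncN (l - f x)) opprB nc_sub_le.
Qed.

Lemma cvg_realC (T : Type) (F : set_system T) (FF : Filter F) (f : T -> R) (a : R) :
  f x @[x --> F] --> a -> ((f x)%:C : Cplx R) @[x --> F] --> (a%:C : Cplx R).
Proof.
move=> /cvgrPdist_lt h; apply/cvgrPdist_lt => e e0.
have ee : e = (Re e)%:C.
  by move: e0; case: e => x y; rewrite ltcE /= => /andP[/eqP -> _].
have := h (Re e); move: (e0); rewrite ltcE => /andP[_ e1] /(_ e1).
by apply: filterS => x; rewrite -rmorphB normrE nc_real ee ltcR.
Qed.

Lemma nc_cvg_le (T : Type) (F : set_system T) (FF : ProperFilter F) (f : T -> Cplx R) l B :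
  f x @[x --> F] --> l -> (\forall x \near F, nc (f x) <= B) -> nc l <= B.
Proof. by move=> /cvg_nc h fB; apply: (cvgr_to_le h). Qed.

Lemma nc_cvg_ge (T : Type) (F : set_system T) (FF : ProperFilter F) (f : T -> Cplx R) l B :
  f x @[x --> F] --> l -> (\forall x \near F, B <= nc (f x)) -> B <= nc l.
Proof. by move=> /cvg_nc h fB; apply: (cvgr_to_ge h). Qed.

End UltraLimits.


(** * Estimates for finite products *)

Section ProductEstimates.
Variables (R : realType) (A : pred nat) (x : nat -> R).
Hypothesis x_ge0 : forall j, 0 <= x j.
Implicit Types (z h : R[i]) (r : seq nat).

Lemma prod_1D_ge1 r (t : R) : 0 <= t -> 1 <= \prod_(j <- r | A j) (1 + x j * t).
Proof.
move=> t0; rewrite [leLHS](_ : _ = \prod_(j <- r | A j) (1 : R)); last by rewrite big1_eq.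
by apply: ler_prod => j _; rewrite ler01 lerDl mulr_ge0.
Qed.

Lemma prod_1D_expR r (t : R) : 0 <= t ->
  \prod_(j <- r | A j) (1 + x j * t) <= expR (t * \sum_(j <- r | A j) x j).
Proof.
move=> t0; rewrite mulr_sumr expR_sum; apply: ler_prod => j _.
by rewrite addr_ge0 ?mulr_ge0 // (mulrC t) expR_ge1Dx.
Qed.

Lemma nc_prod_1D r z :
  nc (\prod_(j <- r | A j) (1 + (x j)%:C * z)) <= \prod_(j <- r | A j) (1 + x j * nc z).
Proof.
rewrite nc_prod; apply: ler_prod => j _; rewrite nc_ge0 /=.
by apply: le_trans (ncD _ _) _; rewrite nc1 ncM nc_real ger0_norm.
Qed.

(** The expanded product has nonnegative coefficients and constant term 1, so subtracting 1
    preserves the domination by its value at [nc z]. This is what bounds tails away from 0. *)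
Lemma nc_prod_1DB1 r z :
  nc (\prod_(j <- r | A j) (1 + (x j)%:C * z) - 1) <= \prod_(j <- r | A j) (1 + x j * nc z) - 1.
Proof.
elim: r => [|j r IH]; first by rewrite !big_nil !subrr nc0.
rewrite !big_cons; case: ifP => // Aj.
set p := \prod_(_ <- r | _) _ in IH *; set P := \prod_(_ <- r | _) _ in IH *.
have -> : (1 + (x j)%:C * z) * p - 1 = (p - 1) + (x j)%:C * z * p by ring.
apply: le_trans (ncD _ _) _.
have -> : (1 + x j * nc z) * P - 1 = (P - 1) + x j * nc z * P by ring.
rewrite lerD // !ncM nc_real ger0_norm // ler_wpM2l ?mulr_ge0 ?nc_ge0 //.
exact: nc_prod_1D.
Qed.

(* The bounds do not depend on the number of factors except through the
   majorant, so they survive in the limit. *)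
Lemma prod_1D_quadratic r z : exists D, forall h, nc h <= 1 ->
  [/\ nc (\prod_(j <- r | A j) (1 + (x j)%:C * (z + h)))
        <= \prod_(j <- r | A j) (1 + x j * (nc z + 1)),
      nc D <= \prod_(j <- r | A j) (1 + x j * (nc z + 1)),
      nc (\prod_(j <- r | A j) (1 + (x j)%:C * (z + h)) -
          \prod_(j <- r | A j) (1 + (x j)%:C * z))
        <= nc h * \prod_(j <- r | A j) (1 + x j * (nc z + 1)) &
      nc (\prod_(j <- r | A j) (1 + (x j)%:C * (z + h)) -
          \prod_(j <- r | A j) (1 + (x j)%:C * z) - h * D)
        <= nc h ^+ 2 * \prod_(j <- r | A j) (1 + x j * (nc z + 1))].
Proof.
elim: r => [|j r [D IH]].
  exists 0 => h h1; rewrite !big_nil subrr mulr0 subrr nc1 nc0 lexx ler01.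
  by rewrite !mulr1 nc_ge0 sqr_ge0.
case Aj: (A j); last by exists D => h /IH; rewrite !big_cons Aj.
(* Product rule for the derivative at [z] after adjoining the factor [j]. *)
exists (D * (1 + (x j)%:C * z) + (x j)%:C * \prod_(j <- r | A j) (1 + (x j)%:C * z)).
move=> h h1; have [i1 i2 i3 i4] := IH h h1.
have h01 : nc (0 : R[i]) <= 1 by rewrite nc0.
have [i0 _ _ _] := IH 0 h01.
rewrite addr0 in i0; rewrite !big_cons Aj.
set F := \prod_(_ <- r | _) _ in i0 i3 i4 *.
set F1 := \prod_(_ <- r | _) _ in i1 i3 i4 *.
set P := \prod_(_ <- r | _) _ in i0 i1 i2 i3 i4 *.
have P0 : 0 <= P by apply: le_trans i0; rewrite nc_ge0.
have z0 := nc_ge0 z; have h0 := nc_ge0 h.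
have xj := x_ge0 j; set y := x j in xj *.
have yz w : nc (1 + y%:C * w) <= 1 + y * nc w.
  by apply: le_trans (ncD _ _) _; rewrite nc1 ncM nc_real ger0_norm.
have k w b : nc w <= b -> nc (w * (1 + y%:C * z)) <= b * (1 + y * nc z).
  by move=> wb; rewrite ncM ler_pM ?nc_ge0.
have k' w b : nc w <= b -> nc (y%:C * w) <= y * b.
  by move=> wb; rewrite ncM nc_real ger0_norm // ler_wpM2l.
split.
- rewrite ncM mulrC [leRHS]mulrC ler_pM ?nc_ge0 //.
  by apply: le_trans (yz _) _; rewrite lerD2l ler_wpM2l // (le_trans (ncD _ _)) // lerD2l.
- apply: le_trans (ncD _ _) _.
  have -> : (1 + y * (nc z + 1)) * P = P * (1 + y * nc z) + y * P by ring.
  by apply: lerD; [exact: k|exact: k'].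
- have -> : (1 + y%:C * (z + h)) * F1 - (1 + y%:C * z) * F =
    (F1 - F) * (1 + y%:C * z) + y%:C * (h * F1) by ring.
  apply: le_trans (ncD _ _) _.
  have -> : nc h * ((1 + y * (nc z + 1)) * P) =
    (nc h * P) * (1 + y * nc z) + y * (nc h * P) by ring.
  by apply: lerD; [exact: k|apply: k'; rewrite ncM ler_wpM2l].
- have -> : (1 + y%:C * (z + h)) * F1 - (1 + y%:C * z) * F -
      h * (D * (1 + y%:C * z) + y%:C * F) =
    (F1 - F - h * D) * (1 + y%:C * z) + y%:C * (h * (F1 - F)) by ring.
  apply: le_trans (ncD _ _) _.
  have -> : nc h ^+ 2 * ((1 + y * (nc z + 1)) * P) =
    (nc h ^+ 2 * P) * (1 + y * nc z) + y * (nc h * (nc h * P)) by ring.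
  by apply: lerD; [exact: k|apply: k'; rewrite ncM ler_wpM2l].
Qed.

End ProductEstimates.

Lemma quadratic_derivable (R : realType) (f : Cplx R -> Cplx R) (z D : Cplx R) (K : R) :
  (forall h, nc h <= 1 -> nc (f (z + h) - f z - h * D) <= nc h ^+ 2 * K) ->
  derivable f z 1.
Proof.
move=> H; apply/cvg_ex; exists D; apply/cvgrPdist_le => e e0.
have ee : e = (Re e)%:C.
  by move: e0; case: e => a b; rewrite ltcE /= => /andP[/eqP -> _].
have e1 : 0 < Re e by move: e0; rewrite ltcE => /andP[].
have K0 : 0 < `|K| + 1 by rewrite ltr_wpDl.
pose d : R := Num.min 1 (Re e / (`|K| + 1)).
have d0 : 0 < d by rewrite lt_min ltr01 divr_gt0.
near=> h.
have hn0 : h != 0 by near: h; exact: nbhs_dnbhs_neq.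
have hd : nc h < d.
  rewrite -ltcR -normrE; near: h; apply: dnbhs0_lt.
  by rewrite -(rmorph0 (real_complex R)) ltcR.
rewrite ee normrE lecR.
have h0 : 0 < nc h by rewrite nc_gt0.
have -> : D - h^-1 *: (f (h *: (1 : Cplx R) + z) - f z) = - (h^-1 * (f (z + h) - f z - h * D)).
  have -> : h *: (1 : Cplx R) + z = z + h by rewrite /GRing.scale /= mulr1 addrC.
  by rewrite /GRing.scale /= [in RHS]mulrBr mulKf // opprB.
rewrite ncN ncM ncV mulrC ler_pdivrMr //.
apply: le_trans (H _ _) _.
  by apply: le_trans (ltW hd) _; rewrite /d ge_min lexx.
rewrite expr2 -mulrA mulrC ler_pM2r //.
apply: le_trans (_ : d * (`|K| + 1) <= _).
  apply: le_trans (_ : nc h * (`|K| + 1) <= _); last by rewrite ler_wpM2r ?ltW.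
  by rewrite ler_wpM2l ?nc_ge0 // (le_trans (ler_norm K)) // lerDl.
by rewrite -ler_pdivlMr // /d ge_min lexx orbT.
Unshelve. all: by end_near. Qed.


(** * Limits of the masked products *)

Section MaskedProductLimits.
Variables (R : realType) (nu : nat -> nat -> R) (c : R) (U : set_system nat).
Hypothesis nuP : forall N j, 0 <= nu N j <= c / j.+1%:R ^+ 2.
Hypothesis UU : UltraFilter U.
Hypothesis oo_sub_U : (\oo : set_system nat) `<=` U.
Implicit Types (A B : pred nat) (z h : Cplx R).

Let nu_ge0 N j : 0 <= nu N j. Proof. by have /andP[] := nuP N j. Qed.

Let c_ge0 : 0 <= c.
Proof.
have /andP[h1 h2] := nuP 0 0; have := le_trans h1 h2.
by rewrite expr1n divr1.
Qed.

Let UP : ProperFilter U. Proof. exact: ultra_proper. Qed.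

(** The mask [A] makes it possible to split off finitely many factors, such as those vanishing at a
    given point, and still take the limit of the rest. *)
Definition mprod A N z : Cplx R := \prod_(0 <= j < N.+2 | A j) (1 + (nu N j)%:C * z).

Lemma masked_sum_le A N M : (forall j, A j -> (M <= j)%N) ->
  \sum_(0 <= j < N.+2 | A j) nu N j <= 2 * c / M.+1%:R.
Proof.
move=> AM; apply: le_trans (_ : \sum_(0 <= j < N.+2 | (M <= j)%N) nu N j <= _).
  rewrite [leLHS]big_mkcond [leRHS]big_mkcond; apply: ler_sum => j _ /=.
  by case: ifP => [/AM ->//|_]; case: ifP.
have [NM|MN] := leqP N.+2 M.
  rewrite big_nat_cond big1 ?divr_ge0 ?mulr_ge0 // => j /andP[/andP[_ jN] Mj].
  by move: (leq_ltn_trans (leq_trans NM Mj) jN); rewrite ltnn.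
rewrite (big_cat_nat (leq0n M) (ltnW MN)) /= big_nat_cond big1 ?add0r; last first.
  by move=> j /andP[/andP[_ jM]]; rewrite leqNgt jM.
apply: le_trans (_ : \sum_(M <= j < N.+2) c / j.+1%:R ^+ 2 <= _).
  rewrite [leLHS]big_mkcond; apply: ler_sum => j _ /=.
  have /andP[h1 h2] := nuP N j.
  by case: ifP => // _; apply: le_trans h2.
rewrite -mulr_sumr [2 * c]mulrC -mulrA ler_wpM2l //.
exact: sum_inv_sqr_le.
Qed.

Lemma majorant_le A N M (t : R) : 0 <= t -> (forall j, A j -> (M <= j)%N) ->
  \prod_(0 <= j < N.+2 | A j) (1 + nu N j * t) <= expR (t * (2 * c / M.+1%:R)).
Proof.
move=> t0 AM; apply: le_trans (prod_1D_expR _ _ _ _) _ => //.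
by rewrite ler_expR ler_wpM2l // masked_sum_le.
Qed.

Lemma nc_mprod_le A N M z : (forall j, A j -> (M <= j)%N) ->
  nc (mprod A N z) <= expR (nc z * (2 * c / M.+1%:R)).
Proof.
move=> AM; apply: le_trans (nc_prod_1D _ _ _ _) _ => //.
by apply: majorant_le => //; exact: nc_ge0.
Qed.

(** The hypothesis makes the exponent [e] of the majorant at most 1/3, and [exp(1/3) <= 3/2] because
    [exp(-e) >= 1 - e >= 2/3]. So the product stays within 1/2 of 1. *)
Lemma nc_mprod_ge A N M z : (forall j, A j -> (M <= j)%N) ->
  6 * c * nc z <= M.+1%:R -> 2^-1 <= nc (mprod A N z).
Proof.
move=> AM zM; have := nc_prod_1DB1 A (nu_ge0 N) (index_iota 0 N.+2) z.
have := majorant_le N (nc_ge0 z) AM.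
set e := nc z * _; have e3 : e <= 3^-1.
  rewrite /e mulrA ler_pdivrMr // mulrC; move: zM; set m := M.+1%:R; lra.
have : expR e <= 3 / 2.
  have := expR_ge1Dx (- e); rewrite expRN => h.
  have e0 := expR_gt0 e.
  have : 2 / 3 <= (expR e)^-1 by apply: le_trans h; lra.
  rewrite -[X in X <= _]invrK lef_pV2 ?posrE ?invr_gt0 ?divr_gt0 //.
  by rewrite invfM invrK mulrC.
rewrite -/(mprod A N z); move: (\prod_(_ <= _ < _ | _) _) => P h1 h2 h3.
have := nc_sub_le 1 (1 - mprod A N z); rewrite subKr nc1 -(ncN (1 - _)) opprB.
lra.
Qed.

Definition mlim A z : Cplx R := lim (mprod A N z @[N --> U]).

Lemma mlim_cvg A z : mprod A N z @[N --> U] --> mlim A z.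
Proof.
have [N|l hl] := @complex_ultra_cvg _ U UU (fun N => mprod A N z)
    (expR (nc z * (2 * c / 1%:R))); first exact: nc_mprod_le.
exact: cvgP hl.
Qed.

Lemma mlim_eq A z l : mprod A N z @[N --> U] --> l -> mlim A z = l.
Proof. by apply: cvg_lim; exact: norm_hausdorff. Qed.

(** The second-order Taylor bound has the same constant [K] for all [N]. The derivatives [D N] are
    bounded by [K] as well, hence converge along [U], and the bound survives in the limit. *)
Lemma mlim_derivable A z : derivable (mlim A) z 1.
Proof.
pose K := expR ((nc z + 1) * (2 * c / 1%:R)).
have z1 : 0 <= nc z + 1 by rewrite addr_ge0 ?nc_ge0.
have AP N : \prod_(0 <= j < N.+2 | A j) (1 + nu N j * (nc z + 1)) <= K.
  exact: (@majorant_le A N 0 _ z1 (fun j _ => leq0n j)).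
have H N : exists D : Cplx R, forall h, nc h <= 1 -> nc D <= K /\
    nc (mprod A N (z + h) - mprod A N z - h * D) <= nc h ^+ 2 * K.
  have [D HD] := prod_1D_quadratic A (nu_ge0 N) (index_iota 0 N.+2) z.
  exists D => h /HD[_ h2 _ h4]; split; first exact: le_trans h2 _.
  by apply: le_trans h4 _; rewrite ler_wpM2l ?sqr_ge0.
have [D HD] := choice H.
have h01 : nc (0 : Cplx R) <= 1 by rewrite nc0.
have [d dP] := complex_ultra_cvg UU (fun N => (HD N 0 h01).1).
apply: (@quadratic_derivable R _ z d K) => h h1.
apply: (@nc_cvg_le _ _ U _ (fun N => mprod A N (z + h) - mprod A N z - h * D N)).
  apply: cvgB; first by apply: cvgB; exact: mlim_cvg.
  by apply: cvgM; [exact: cvg_cst|exact: dP].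
by near=> N; have [] := HD N h h1.
Unshelve. all: by end_near. Qed.

Definition nulim j : R := lim (nu N j @[N --> U]).

Lemma nulim_cvg j : nu N j @[N --> U] --> nulim j.
Proof.
have [N|l hl] := @real_ultra_cvg _ U UU (nu ^~ j) (c / j.+1%:R ^+ 2).
  by rewrite ger0_norm; have /andP[] := nuP N j.
exact: cvgP hl.
Qed.

Lemma nulimP j : 0 <= nulim j <= c / j.+1%:R ^+ 2.
Proof.
apply/andP; split.
  by apply: (cvgr_to_ge (@nulim_cvg j)); near=> N.
by apply: (cvgr_to_le (@nulim_cvg j)); near=> N; have /andP[] := nuP N j.
Unshelve. all: by end_near. Qed.

Lemma nulim_mono : (forall N i j, (i <= j)%N -> nu N j <= nu N i) ->
  forall i j, (i <= j)%N -> nulim j <= nulim i.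
Proof.
move=> mono i j ij; apply: (ler_cvg_to (@nulim_cvg j) (@nulim_cvg i)).
by near=> N; exact: mono.
Unshelve. all: by end_near. Qed.

Lemma mlim_split A B M z : (forall j, B j -> (j < M)%N) ->
  mlim A z = \prod_(0 <= j < M | A j && B j) (1 + (nulim j)%:C * z) *
             mlim (fun j => A j && ~~ B j) z.
Proof.
move=> BM; apply: mlim_eq.
have h : (\prod_(0 <= j < M | A j && B j) (1 + (nu N j)%:C * z) *
    mprod (fun j => A j && ~~ B j) N z : Cplx R) @[N --> U] -->
  (\prod_(0 <= j < M | A j && B j) (1 + (nulim j)%:C * z) *
   mlim (fun j => A j && ~~ B j) z : Cplx R).
  apply: cvgM; last exact: mlim_cvg.
  move: (index_iota 0 M) => r0; elim: r0 => [|j r IH].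
    by under eq_fun do rewrite big_nil; rewrite big_nil; exact: cvg_cst.
  under eq_fun do rewrite big_cons; rewrite big_cons; case: ifP => _; last exact: IH.
  apply: cvgM IH; apply: cvgD; first exact: cvg_cst.
  by apply: cvgM; [exact: cvg_realC (@nulim_cvg j)|exact: cvg_cst].
apply: cvg_trans h; apply: near_eq_cvg; apply: oo_sub_U.
exists M => // N /= MN; rewrite /mprod [RHS](bigID B) /=; congr (_ * _).
have MN2 : (M <= N.+2)%N by rewrite (leq_trans MN) // -addn2 leq_addr.
rewrite [RHS](big_cat_nat (leq0n M) MN2) /=.
rewrite [X in _ = _ * X]big_nat_cond [X in _ = _ * X]big1 ?mulr1 //.
by move=> j /andP[/andP[Mj _] /andP[_ /BM]]; rewrite ltnNge Mj.
Qed.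

(** From index [M > 6 c |z|] on, the partial products have modulus at least 1/2, hence so does their
    limit. The finitely many other factors are nonzero by hypothesis. *)
Lemma mlim_neq0 A z : (forall j, A j -> 1 + (nulim j)%:C * z != 0) -> mlim A z != 0.
Proof.
move=> Az; have zr : 0 <= 6 * c * nc z by rewrite !mulr_ge0 ?nc_ge0.
pose M := (Num.bound (6 * c * nc z)); have Mz : 6 * c * nc z < M%:R.
  exact: (archi_boundP zr).
rewrite (@mlim_split A (fun j => (j < M)%N) M) // mulf_neq0 //.
  rewrite prodf_seq_neq0; apply/allP => j _; apply/implyP => /andP[+ _].
  exact: Az.
set B := (fun j => A j && _); have BM j : B j -> (M <= j)%N.
  by move=> /andP[_]; rewrite -leqNgt.
rewrite -nc_gt0; apply: lt_le_trans (_ : 2^-1 <= _); first by rewrite invr_gt0.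
apply: (@nc_cvg_ge _ _ U _ (fun N => mprod B N z)); first exact: mlim_cvg.
near=> N; apply: (nc_mprod_ge N BM).
by rewrite (le_trans (ltW Mz)) // ler_nat.
Unshelve. all: by end_near. Qed.

Lemma nc_mlim_le z M : nc (mlim xpredT z) <=
  (\prod_(0 <= j < M) (1 + nulim j * nc z)) * expR (nc z * (2 * c / M.+1%:R)).
Proof.
rewrite (@mlim_split xpredT (fun j => (j < M)%N) M) // ncM.
apply: ler_pM; rewrite ?nc_ge0 //.
  rewrite big_nat_cond [leRHS]big_nat_cond.
  rewrite (eq_bigl (fun j => (0 <= j < M)%N && true)); last by move=> j /=; case: (_ < _)%N.
  apply: nc_prod_1D => j; by have /andP[] := nulimP j.
set B := (fun j => _); have BM j : B j -> (M <= j)%N by rewrite /B /= -leqNgt.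
apply: (@nc_cvg_le _ _ U _ (fun N => mprod B N z)); first exact: mlim_cvg.
by near=> N; apply: (nc_mprod_le N z BM).
Unshelve. all: by end_near. Qed.

End MaskedProductLimits.


(** * Elementary bound for the product of the hyperbolic sine *)

Section SinhProduct.
Variable R : realType.

Lemma expR1_ge2 : 2 <= expR 1 :> R.
Proof. by have := expR_ge1Dx (1 : R); lra. Qed.

(** The infinite product is [sinh(pi s)/(pi s)]. Factors of index below [s] are at most
    [2 s^2/(j+1)^2] and contribute [2^s (s^s/s!)^2 <= e^(3s)]; the tail contributes
    [exp(2 s^2/(s+1)) <= e^(2s)]. *)
Lemma prod_sinh_nat_le n s :
  \prod_(0 <= j < n) (1 + s%:R ^+ 2 / j.+1%:R ^+ 2) <= expR (5 * s%:R) :> R.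
Proof.
have f0 j : 0 <= s%:R ^+ 2 / j.+1%:R ^+ 2 :> R by rewrite divr_ge0 ?sqr_ge0.
have f1 j : 0 <= 1 + s%:R ^+ 2 / j.+1%:R ^+ 2 :> R by rewrite addr_ge0.
apply: le_trans (_ : \prod_(0 <= j < s + n) (1 + s%:R ^+ 2 / j.+1%:R ^+ 2) <= _).
  rewrite [leRHS](big_cat_nat (leq0n n) (leq_addl s n)) /= -[leLHS]mulr1.
  apply: ler_pM => //; first by apply: prodr_ge0.
  have := prod_1D_ge1 xpredT f0 (index_iota n (s + n)) (@ler01 R).
  by under eq_bigr do rewrite mulr1.
rewrite (big_cat_nat (leq0n s) (leq_addr n s)) /=.
have h1 : \prod_(0 <= j < s) (1 + s%:R ^+ 2 / j.+1%:R ^+ 2) <= expR (3 * s%:R) :> R.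
  apply: le_trans (_ : \prod_(0 <= j < s) (2 * (s%:R ^+ 2 / j.+1%:R ^+ 2)) <= _).
    rewrite big_nat [leRHS]big_nat; apply: ler_prod => j /andP[_ js]; rewrite f1 /=.
    suff : 1 <= s%:R ^+ 2 / j.+1%:R ^+ 2 :> R by set u := _ / _; lra.
    by rewrite ler_pdivlMr ?exprn_gt0 // mul1r ler_pXn2r ?nnegrE // ler_nat.
  have -> k : \prod_(0 <= j < k) (2 * (s%:R ^+ 2 / j.+1%:R ^+ 2)) =
      2 ^+ k * (s%:R ^+ k / k`!%:R) ^+ 2 :> R.
    elim: k => [|k IH]; first by rewrite big_geq // !expr0 divr1 expr1n mulr1.
    rewrite big_nat_recr //= {}IH factS natrM !exprS.
    by field; rewrite nat1r !pnatr_eq0 -!lt0n fact_gt0.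
  have -> : 3 * s%:R = s%:R + s%:R * 2 :> R by ring.
  rewrite expRD expRM_natr ler_pM ?exprn_ge0 ?sqr_ge0 //.
    have -> : expR s%:R = expR 1 ^+ s :> R by rewrite -expRM_natl mulr1.
    by apply: lerXn2r; rewrite ?nnegrE ?expR_ge0 // expR1_ge2.
  by apply: lerXn2r; rewrite ?nnegrE ?expR_ge0 ?divr_ge0 ?exprn_ge0 // expn_div_fact_le.
have h2 : \prod_(s <= j < s + n) (1 + s%:R ^+ 2 / j.+1%:R ^+ 2) <= expR (2 * s%:R) :> R.
  have := @prod_1D_expR R xpredT (fun j => j.+1%:R ^- 2) _ (index_iota s (s + n)) (s%:R ^+ 2).
  under eq_bigr do rewrite mulrC; move=> h.
  apply: le_trans (h _ _) _ => [j||]; rewrite ?invr_ge0 ?sqr_ge0 // ler_expR.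
  apply: le_trans (ler_wpM2l (sqr_ge0 _) (sum_inv_sqr_le R s (s + n))) _.
  rewrite mulrA ler_pdivrMr // -natr1 expr2.
  have : 0 <= s%:R :> R by []. nra.
have -> : 5 * s%:R = 3 * s%:R + 2 * s%:R :> R by ring.
by rewrite expRD ler_pM // prodr_ge0.
Qed.

Lemma prod_sinh_le n (t : R) : 0 <= t ->
  \prod_(0 <= j < n) (1 + t / j.+1%:R ^+ 2) <= expR (5 * (Num.sqrt t + 1)).
Proof.
move=> t0; set x := Num.sqrt t; have x0 : 0 <= x by exact: sqrtr_ge0.
have /andP[s1 s2] := truncn_itv x0; set s := Num.truncn x in s1 s2.
apply: le_trans (_ : \prod_(0 <= j < n) (1 + s.+1%:R ^+ 2 / j.+1%:R ^+ 2) <= _).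
  apply: ler_prod => j _; rewrite addr_ge0 ?divr_ge0 ?sqr_ge0 //= lerD2l.
  rewrite ler_pM2r ?invr_gt0 ?exprn_gt0 // -(sqr_sqrtr t0) ler_pXn2r ?nnegrE //.
  exact: ltW.
apply: le_trans (prod_sinh_nat_le _ _) _; rewrite ler_expR ler_wpM2l //.
by rewrite -natr1 lerD2r.
Qed.

End SinhProduct.

(** * The entire solution of the difference equation *)

Section EntireSolution.
Variable R : realType.

(** All that is used of [y] later, freed from the approximation. [sol_factor] is the product
    expansion in local form: the factors vanishing at [z0] are split off from an entire function
    that is nonzero there. *)
Record solution_data (y : Cplx R -> Cplx R) (nu : nat -> R) (c d : R) : Prop := SolutionData {
  sol_c : 0 < c;
  sol_nu : forall j, 0 <= nu j <= c / j.+1%:R ^+ 2;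
  sol_mono : forall i j, (i <= j)%N -> nu j <= nu i;
  sol_rec : forall z, (z + 2) * y (z + 2) - 2 * (z + 2) * y (z + 1) + (z + 1) * y z = 0;
  sol_zero : forall z, y z = 0 -> y (z + 1) != 0;
  sol_der : forall z, derivable y z 1;
  sol_factor : forall z0 M, (forall j, (M <= j)%N -> 1 + (nu j)%:C * z0 != 0) ->
    exists H : Cplx R -> Cplx R, [/\ forall z, derivable H z 1, H z0 != 0 &
      forall z, y z = \prod_(0 <= j < M | 1 + (nu j)%:C * z0 == 0) (1 + (nu j)%:C * z) * H z];
  sol_shift : forall z s, 0 < s -> (forall t : R, 0 <= t -> s <= nc (1 + t%:C * z)) ->
    nc (y (z + 1)) <= nc (y z) * expR (5 * (Num.sqrt (c / s) + 1));
  sol_d : 0 < d;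
  sol_large : forall J, exists2 j, (J <= j)%N & d / j.+1%:R ^+ 2 <= nu j }.

Variables (nu : nat -> nat -> R) (c : R) (U : set_system nat).
Hypothesis c_gt0 : 0 < c.
Hypothesis nuP : forall N j, 0 <= nu N j <= c / j.+1%:R ^+ 2.
Hypothesis nu_mono : forall N i j, (i <= j)%N -> nu N j <= nu N i.
Hypothesis nuE : forall N z, meixner (N.+2%:R^-1)%:C N.+2 z =
  \prod_(j < N.+2) (1 + (nu N j)%:C * z).
Hypothesis UU : UltraFilter U.
Hypothesis oo_sub_U : (\oo : set_system nat) `<=` U.
Implicit Types (z : Cplx R).

Local Notation F := (mprod nu xpredT).
Local Notation y := (mlim nu U xpredT).
Local Notation mu := (nulim nu U).

Let UP : ProperFilter U. Proof. exact: ultra_proper. Qed.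

Let FE N z : F N z = meixner (N.+2%:R^-1)%:C N.+2 z.
Proof. by rewrite nuE /mprod big_mkord. Qed.

Let ycvg z : F N z @[N --> U] --> y z.
Proof. exact: mlim_cvg. Qed.

Let inv_cvg0 : N.+2%:R^-1 @[N --> U] --> (0 : R).
Proof.
have h : N.+1%:R^-1 @[N --> \oo] --> (0 : R) by exact: (@cvg_harmonic R).
have h2 : N.+2%:R^-1 @[N --> \oo] --> (0 : R).
  by rewrite (@cvg_shiftS _ (fun N => N.+1%:R^-1 : R)); exact: h.
by move=> V /h2 hV; exact: oo_sub_U.
Qed.

(** Limit of [meixner_diff] with [a = 1/n]: [a] tends to 0 while [a n = 1] keeps the last term
    alive. *)
Lemma solution_rec0 z : (z + 1) * (y (z + 1) - y z) = z * (y z - y (z - 1)) + y z.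
Proof.
have uniq := @norm_hausdorff _ (Cplx R).
pose a N : Cplx R := (N.+2%:R^-1 : R)%:C.
have a0 : a N @[N --> U] --> (0 : Cplx R).
  exact: (@cvg_realC R _ U _ _ _ inv_cvg0).
have h1 : ((z + 1) * (F N (z + 1) - F N z) : Cplx R) @[N --> U] --> ((z + 1) * (y (z + 1) - y z) : Cplx R).
  by apply: cvgM; [exact: cvg_cst|apply: cvgB; exact: ycvg].
have h2 : ((1 - a N) * z * (F N z - F N (z - 1)) + F N z : Cplx R) @[N --> U] -->
    ((1 - 0) * z * (y z - y (z - 1)) + y z : Cplx R).
  apply: cvgD; last exact: ycvg.
  apply: cvgM; last by apply: cvgB; exact: ycvg.
  apply: cvgM; last exact: cvg_cst.
  by apply: cvgB; [exact: cvg_cst|exact: a0].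
rewrite subr0 mul1r in h2; apply: (cvg_unique uniq h1).
rewrite (_ : (fun N => _) = (fun N => ((1 - a N) * z * (F N z - F N (z - 1)) + F N z : Cplx R))) //.
apply/funext => N; rewrite !FE meixner_diff; congr (_ + _).
have -> : (N.+2%:R^-1)%:C * N.+2%:R = 1 :> R[i].
  by rewrite -(rmorph_nat (real_complex R)) -rmorphM mulVf ?rmorph1 // pnatr_eq0.
by rewrite mul1r.
Qed.

Lemma solution_rec z : (z + 2) * y (z + 2) - 2 * (z + 2) * y (z + 1) + (z + 1) * y z = 0.
Proof.
have := solution_rec0 (z + 1); rewrite addrK -addrA (_ : 1 + 1 = 2) // => h.
have -> : (z + 2) * y (z + 2) - 2 * (z + 2) * y (z + 1) + (z + 1) * y z =
  (z + 2) * (y (z + 2) - y (z + 1)) - (z + 2) * y (z + 1) + (z + 1) * y z by ring.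
by rewrite h; ring.
Qed.

(** The approximants take the value [(1 - 1/n)^n], which is at least [e^-2] because
    [(1 + 2/n)(1 - 1/n) >= 1] for [n >= 2]. *)
Let yN1 : y (-1) != 0.
Proof.
rewrite -nc_gt0; apply: lt_le_trans (expR_gt0 (-2)) _.
apply: (@nc_cvg_ge _ _ U _ (fun N => F N (-1))); first exact: ycvg.
near=> N.
rewrite FE meixnerN1 ncX; have -> : 1 - (N.+2%:R^-1)%:C = (1 - N.+2%:R^-1)%:C :> R[i].
  by rewrite rmorphB rmorph1.
rewrite nc_real.
have p0 : 0 <= 1 - N.+2%:R^-1 :> R by rewrite subr_ge0 invf_le1 // ler1n.
rewrite ger0_norm //.
have -> : -2 = N.+2%:R * (- (2 / N.+2%:R)) :> R.
  by rewrite mulrN mulrCA divff ?mulr1 // pnatr_eq0.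
rewrite expRM_natl; apply: lerXn2r; rewrite ?nnegrE ?expR_ge0 //.
rewrite expRN -[leRHS]invrK lef_pV2 ?posrE ?expR_gt0 ?invr_gt0 //; last first.
  by rewrite subr_gt0 invf_lt1 // ltr1n.
apply: le_trans (expR_ge1Dx _).
have n2 : 2 <= N.+2%:R :> R by rewrite ler_nat.
set x := N.+2%:R in n2 *.
rewrite -[leLHS]mul1r ler_pdivrMr; last by rewrite subr_gt0 invf_lt1; lra.
rewrite -subr_ge0.
have -> : (1 + 2 / x) * (1 - x^-1) - 1 = (x - 2) / x ^+ 2 by field; lra.
by rewrite divr_ge0 ?sqr_ge0; lra.
Unshelve. all: by end_near. Qed.

Let ynonneg (x : R) : 0 <= x -> y x%:C != 0.
Proof.
move=> x0; apply: (mlim_neq0 nuP UU oo_sub_U) => j _.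
have /andP[m0 _] := nulimP nuP UU j.
rewrite -rmorphM -(rmorph1 (real_complex R)) -rmorphD realC_eq0 gt_eqF //.
by rewrite ltr_pwDl // mulr_ge0.
Qed.

(* Two consecutive zeros propagate to the right; the leading coefficient of
   the recurrence only vanishes at -2, where y(-1) <> 0 stops them. *)
Let consecutive_zeros (n : nat) (x : R) : - n%:R <= x -> y x%:C = 0 ->
  y (x%:C + 1) = 0 -> False.
Proof.
elim: n x => [|n IH] x nx y0 y1.
  by move: nx; rewrite mulr0n oppr0 => /ynonneg; rewrite y0 eqxx.
have e1 : x%:C + 1 = (x + 1)%:C :> R[i] by rewrite rmorphD rmorph1.
have e2 : x%:C + 2 = (x + 2)%:C :> R[i] by rewrite rmorphD rmorph_nat.
have [x2|x2] := eqVneq x (-2).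
  move: yN1; rewrite -y1 e1 x2 (_ : -2 + 1 = -1 :> R); last by ring.
  by rewrite rmorphN rmorph1 eqxx.
apply: (IH (x + 1)); rewrite -?e1 //.
  by move: nx; rewrite -natr1; lra.
have := solution_rec x%:C; rewrite y0 y1 !mulr0 subr0 addr0 => /eqP.
rewrite mulf_eq0 => /orP[|/eqP <-]; last by congr y; ring.
by rewrite e2 realC_eq0 addr_eq0 (negbTE x2).
Qed.

(** Zeros are of the form [-1/mu_j], so two consecutive ones would be real and propagate to the
    nonnegative axis. Consequently no zero of the denominator of [f] is cancelled. *)
Lemma solution_zero z : y z = 0 -> y (z + 1) != 0.
Proof.
move=> y0; apply/eqP => y1.
have [j ej] : exists j, 1 + (mu j)%:C * z = 0.
  apply/not_existsP => h; move/eqP: y0; apply/negP.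
  by apply: (mlim_neq0 nuP UU oo_sub_U) => j _; apply/eqP; exact: h.
have m0 : (mu j)%:C != 0 :> R[i].
  by apply/eqP => m0; move: ej; rewrite m0 mul0r addr0 => /eqP; rewrite oner_eq0.
have ez : z = (- (mu j)^-1)%:C.
  apply: (mulfI m0); rewrite -rmorphM mulrN mulfV -?realC_eq0 // rmorphN rmorph1.
  by apply/eqP; rewrite -addr_eq0 addrC ej.
have mj : 0 <= (mu j)^-1 by rewrite invr_ge0; have /andP[] := nulimP nuP UU j.
have h := archi_boundP mj.
apply: (@consecutive_zeros (Num.bound (mu j)^-1) (- (mu j)^-1)); rewrite -?ez //.
by rewrite lerN2 ltW.
Qed.

Lemma solution_factor z0 M : (forall j, (M <= j)%N -> 1 + (mu j)%:C * z0 != 0) ->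
  exists H : Cplx R -> Cplx R, [/\ forall z, derivable H z 1, H z0 != 0 &
    forall z, y z = \prod_(0 <= j < M | 1 + (mu j)%:C * z0 == 0) (1 + (mu j)%:C * z) * H z].
Proof.
move=> hM; pose B j := 1 + (mu j)%:C * z0 == 0.
exists (mlim nu U (fun j => xpredT j && ~~ B j)); split.
- by move=> z; exact: (mlim_derivable nuP UU).
- by apply: (mlim_neq0 nuP UU oo_sub_U) => j.
- move=> z; apply: (mlim_split nuP UU oo_sub_U xpredT) => j.
  by rewrite ltnNge; apply: contraL; exact: hM.
Qed.

(** Factorwise, [|1 + nu (z+1)| <= |1 + nu z| + nu <= |1 + nu z| (1 + nu/s)], and
    [nu/s <= (c/s)/(j+1)^2] reduces the quotient to [prod_sinh_le]. *)
Lemma solution_shift z s : 0 < s -> (forall t : R, 0 <= t -> s <= nc (1 + t%:C * z)) ->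
  nc (y (z + 1)) <= nc (y z) * expR (5 * (Num.sqrt (c / s) + 1)).
Proof.
move=> s0 hs; set K := expR _.
have h1 : nc (F N (z + 1)) @[N --> U] --> nc (y (z + 1)) by apply: cvg_nc; exact: ycvg.
have h2 : nc (F N z) * K @[N --> U] --> nc (y z) * K.
  by apply: cvgM; [apply: cvg_nc; exact: ycvg|exact: cvg_cst].
apply: (ler_cvg_to h1 h2).
near=> N; apply: le_trans (_ : nc (F N z) *
    \prod_(0 <= j < N.+2) (1 + (c / s) / j.+1%:R ^+ 2) <= _); last first.
  by rewrite ler_wpM2l ?nc_ge0 // prod_sinh_le // divr_ge0 // ltW.
rewrite /mprod !nc_prod -big_split /=; apply: ler_prod => j _; rewrite nc_ge0 /=.
have /andP[n0 nc'] := nuP N j; have hj := hs _ n0.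
have -> : 1 + (nu N j)%:C * (z + 1) = (1 + (nu N j)%:C * z) + (nu N j)%:C by ring.
apply: le_trans (ncD _ _) _; rewrite mulrDr mulr1 lerD2l nc_real ger0_norm //.
apply: le_trans nc' _; rewrite (_ : c / s / _ = s^-1 * (c / j.+1%:R ^+ 2)); last first.
  by rewrite mulrAC mulrC.
rewrite mulrA -[leLHS]mul1r ler_wpM2r ?divr_ge0 ?sqr_ge0 ?(ltW c_gt0) //.
by rewrite ler_pdivlMr // mul1r.
Unshelve. all: by end_near. Qed.

Lemma solution_growth k : 2 ^+ k <= nc (y (8 * k ^ 2)%:R).
Proof.
apply: (@nc_cvg_ge _ _ U _ (fun N => F N (8 * k ^ 2)%:R)); first exact: ycvg.
apply: oo_sub_U; exists (2 * k)%N => // N /= Nk.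
rewrite FE meixner_natE nc_real; apply: le_trans (ler_norm _).
by apply: meixner_real_ge; rewrite -mul2n (leq_trans Nk) // -addn2 leq_addr.
Qed.

(** Otherwise [y(8 k^2)] is at most a power of [1 + 8 c k^2], with exponent [J], times
    [exp(k/4 + 6)], while it is at least [2^k >= exp(k/2)]. *)
Lemma solution_large J : exists2 j, (J <= j)%N & 3200^-1 / j.+1%:R ^+ 2 <= mu j.
Proof.
apply/not_exists2P => hJ.
have small j : (J <= j)%N -> mu j <= 3200^-1 / j.+1%:R ^+ 2.
  by move=> Jj; have [//|/negP] := hJ j; rewrite -ltNge => /ltW.
have mu0 j : 0 <= mu j by have /andP[] := nulimP nuP UU j.
have muc j : mu j <= c.
  have /andP[_ h] := nulimP nuP UU j; apply: le_trans h _.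
  by rewrite ler_pdivrMr ?exprn_gt0 // ler_peMr ?(ltW c_gt0) // exprn_ege1 // ler1n.
have bound k : expR (k%:R / 4 - 6) <= (1 + c * (8 * k ^ 2)%:R) ^+ J.
  have := le_trans (solution_growth k) (nc_mlim_le nuP UU oo_sub_U _ _).
  have [x xE] : exists x : R, x = (8 * k ^ 2)%:R by eexists.
  have x0 : 0 <= x by rewrite xE.
  (* The constant is [3200 = 8 * 20^2], so [sqrt(x/3200) = k/20], and [prod_sinh_le] costs only
     [exp(k/4 + 5)]. *)
  have [q qE] : exists q : R, q = (k%:R / 20) ^+ 2 by eexists.
  have q0 : 0 <= q by rewrite qE sqr_ge0.
  have xq : 3200^-1 * x = q by rewrite qE xE natrM natrX; field.
  rewrite -(rmorph_nat (real_complex R)) nc_real -xE ger0_norm //.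
  (* Large enough for the tail beyond [M] to cost at most a factor [e]. *)
  pose M := (J + Num.bound (2 * c * x))%N => /(_ M).
  have cx : 0 <= 2 * c * x by rewrite !mulr_ge0 // ltW.
  rewrite (big_cat_nat (leq0n J) (leq_addr _ _)) /= => h.
  have h1 : \prod_(0 <= j < J) (1 + mu j * x) <= (1 + c * x) ^+ J.
    rewrite -[X in _ ^+ X]subn0 -prodr_const_nat; apply: ler_prod => j _.
    by rewrite addr_ge0 ?mulr_ge0 //= lerD2l ler_wpM2r.
  have h2 : \prod_(J <= j < M) (1 + mu j * x) <= expR (k%:R / 4 + 5).
    apply: le_trans (_ : \prod_(J <= j < M) (1 + q / j.+1%:R ^+ 2) <= _).
      rewrite big_nat [leRHS]big_nat; apply: ler_prod => j /andP[Jj _].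
      rewrite addr_ge0 ?mulr_ge0 //= lerD2l -xq mulrAC ler_wpM2r //.
      exact: small.
    have f0 j : 0 <= q / j.+1%:R ^+ 2 by rewrite divr_ge0 // sqr_ge0.
    have f1 j : 0 <= 1 + q / j.+1%:R ^+ 2 by rewrite addr_ge0.
    apply: le_trans (_ : \prod_(0 <= j < M) (1 + q / j.+1%:R ^+ 2) <= _).
      rewrite [leRHS](big_cat_nat (leq0n J) (leq_addr _ _)) /= -[leLHS]mul1r.
      rewrite ler_wpM2r ?prodr_ge0 //.
      have := prod_1D_ge1 xpredT f0 (index_iota 0 J) (@ler01 R).
      by under eq_bigr do rewrite mulr1.
    apply: le_trans (prod_sinh_le _ q0) _.
    rewrite qE sqrtr_sqr ger0_norm ?divr_ge0 // ler_expR.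
    by rewrite le_eqVlt; apply/orP; left; apply/eqP; field.
  have h3 : expR (x * (2 * c / M.+1%:R)) <= expR 1.
    rewrite ler_expR mulrA ler_pdivrMr // mul1r mulrC.
    have := ltW (archi_boundP cx); move/le_trans; apply.
    by rewrite ler_nat ltnW // ltnS leq_addl.
  have h4 : expR (k%:R / 2) <= 2 ^+ k :> R.
    rewrite mulrC expRM_natr; apply: lerXn2r; rewrite ?nnegrE ?expR_ge0 //.
    rewrite -[leLHS]invrK -[leRHS]invrK lef_pV2 ?posrE ?invr_gt0 ?expR_gt0 // -expRN.
    by have := expR_ge1Dx (- 2^-1 : R); lra.
  have p0 (a b : nat) : 0 <= \prod_(a <= j < b) (1 + mu j * x).
    by rewrite prodr_ge0 // => j _; rewrite addr_ge0 ?mulr_ge0.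
  have : expR (k%:R / 2) <= (1 + c * x) ^+ J * expR (k%:R / 4 + 5) * expR 1.
    apply: le_trans h4 (le_trans h _).
    by rewrite ler_pM ?mulr_ge0 ?expR_ge0 // ler_pM.
  rewrite -mulrA -expRD -ler_pdivrMr ?expR_gt0 // -expRN -expRD.
  by rewrite (_ : k%:R / 2 - (k%:R / 4 + 5 + 1) = k%:R / 4 - 6) //; field.
(* With [k/4 - 6 = (J+1) m], a [(J+1)]-th root yields [e^m <= 1 + 8 c k^2]. Since [e^m >= 1 + m^3/6]
   and [k <= 28 (J+1) m], this forces [m <= 48 c 28^2 (J+1)^2 = C]. *)
have [C CE] : exists C : R, C = 48 * c * 784 * J.+1%:R ^+ 2 by eexists.
have C0 : 0 <= C.
  rewrite CE; apply: mulr_ge0; last exact: sqr_ge0.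
  by apply: mulr_ge0; [apply: mulr_ge0; [exact: ler0n|exact: ltW]|exact: ler0n].
have [m m0 m1] : exists2 m, (0 < m)%N & C + 1 < m%:R :> R.
  exists (Num.bound C).+1 => //.
  by rewrite -natr1 ltrD2r archi_boundP.
have m2 : 1 <= m%:R :> R by rewrite ler1n.
have [k kE] : exists k, k = (24 + 4 * (J.+1 * m))%N by eexists.
have := bound k.
have -> : k%:R / 4 - 6 = m%:R * J.+1%:R :> R by rewrite kE natrD !natrM; field.
rewrite expRM_natr => h.
have q1 : 1 <= 1 + c * (8 * k ^ 2)%:R by rewrite lerDl mulr_ge0 // ltW.
have {}h := le_trans h (ler_weXn2l q1 (leqnSn J)).
move: h; rewrite ler_pXn2r ?nnegrE ?expR_ge0 ?(le_trans ler01 q1) // => h.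
have := le_trans (expR_ge1Dxn 2 (le_trans ler01 m2)) h.
rewrite lerD2l natrM natrX.
have kM : k%:R <= 28 * (J.+1%:R * m%:R) :> R.
  rewrite -!natrM ler_nat kE.
  by rewrite -[28%N]/(24 + 4)%N mulnDl leq_add2r leq_pmulr // muln_gt0.
apply/negP; rewrite -ltNge.
have J1 : 1 <= J.+1%:R :> R by rewrite ler1n.
apply: le_lt_trans (_ : c * (8 * (28 * (J.+1%:R * m%:R)) ^+ 2) < _).
  apply: ler_wpM2l; first exact: ltW.
  apply: ler_wpM2l; first exact: ler0n.
  by apply: lerXn2r kM; rewrite nnegrE ?mulr_ge0 ?ler0n.
rewrite ltr_pdivlMr ?ltr0n ?fact_gt0 //.
have -> : 3`!%:R = 6 :> R by rewrite !factS fact0.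
have -> : c * (8 * (28 * (J.+1%:R * m%:R)) ^+ 2) * 6 = C * m%:R ^+ 2 :> R by rewrite CE; ring.
rewrite exprS ltr_pM2r ?exprn_gt0 ?(lt_le_trans ltr01 m2) //.
  by apply: lt_trans m1; rewrite ltrDl.
by rewrite expr1 mulr_gt0 // (lt_le_trans ltr01 m2).
Qed.

Lemma mlim_solution_data : solution_data y mu c 3200^-1.
Proof.
split.
- exact: c_gt0.
- exact: nulimP.
- exact: nulim_mono.
- exact: solution_rec.
- exact: solution_zero.
- by move=> z; exact: (mlim_derivable nuP UU).
- exact: solution_factor.
- exact: solution_shift.
- by rewrite invr_gt0 ltr0n.
- exact: solution_large.
Qed.

End EntireSolution.

Lemma exists_solution (R : realType) : exists y nu c d, @solution_data R y nu c d.
Proof.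
have [nu [c [c0 [nuP mono nuE]]]] := meixner_zeros R.
have [U [UU oU]] := ultraFilterLemma eventually_filter.
by do 4!eexists; exact: (mlim_solution_data c0 nuP mono nuE UU oU).
Qed.


(** * Punctured neighbourhoods and uniqueness of the pole order *)

Section PuncturedNeighborhoods.
Variable R : realType.
Implicit Types (f g : Cplx R -> Cplx R) (z w : Cplx R) (m n : nat).

Lemma derivable_shift f z a : derivable f (z + a) 1 -> derivable (fun w => f (w + a)) z 1.
Proof.
rewrite /derivable.
rewrite (_ : (fun h => h^-1 *: (f (h *: 1 + z + a) - f (z + a))) =
  (fun h => h^-1 *: (f (h *: 1 + (z + a)) - f (z + a)))) //.
by apply/funext => h; rewrite addrA.
Qed.

Lemma derivable_cvg f z : derivable f z 1 -> f w @[w --> z] --> f z.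
Proof. by move=> /derivable1_diffP/differentiable_continuous. Qed.

Lemma cvg_dnbhs f z (l : Cplx R) : f w @[w --> z] --> l -> f w @[w --> z^'] --> l.
Proof. by move=> h V lV; apply: nbhs_dnbhs; exact: h. Qed.

Let cvg_self z : (w : Cplx R) @[w --> z] --> z.
Proof. by move=> V. Qed.

Lemma cvg_cst_at z (a : Cplx R) : (fun=> a) w @[w --> z] --> a.
Proof.
move=> V /nbhs_singleton Va.
by apply: (@filterS _ (nbhs z) _ setT) => [w _|]; [exact: Va|exact: filterT].
Qed.

Lemma cvgD_at f g z (a b : Cplx R) : f w @[w --> z] --> a -> g w @[w --> z] --> b ->
  (f w + g w : Cplx R) @[w --> z] --> (a + b : Cplx R).
Proof. by move=> fa gb; apply: (@cvgD _ _ _ (nbhs z)); [exact: fa|exact: gb]. Qed.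

Lemma cvgB_at f g z (a b : Cplx R) : f w @[w --> z] --> a -> g w @[w --> z] --> b ->
  (f w - g w : Cplx R) @[w --> z] --> (a - b : Cplx R).
Proof. by move=> fa gb; apply: (@cvgB _ _ _ (nbhs z)); [exact: fa|exact: gb]. Qed.

Lemma cvgM_at f g z (a b : Cplx R) : f w @[w --> z] --> a -> g w @[w --> z] --> b ->
  (f w * g w : Cplx R) @[w --> z] --> (a * b : Cplx R).
Proof. by move=> fa gb; apply: (@cvgM _ _ (nbhs z)); [exact: fa|exact: gb]. Qed.

Lemma dnbhs_neq z a : \forall w \near z^', w != a.
Proof.
have [->|za] := eqVneq z a; first exact: nbhs_dnbhs_neq.
have h : (w - a : Cplx R) @[w --> z] --> (z - a : Cplx R) by apply: cvgB_at; [exact: cvg_self|exact: (cvg_cst_at z)].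
have h0 : z - a != 0 by rewrite subr_eq0.
have hn := cvgr_neq0 _ h h0.
near=> w; rewrite -subr_eq0; near: w; apply: nbhs_dnbhs; exact: hn.
Unshelve. all: by end_near. Qed.

Lemma cvg_horner (p : {poly R[i]}) z : (p.[w] : Cplx R) @[w --> z] --> (p.[z] : Cplx R).
Proof.
elim/poly_ind: p => [|p a IH].
  by rewrite horner0; under eq_fun do rewrite horner0; exact: (cvg_cst_at z).
rewrite hornerMXaddC; under eq_fun do rewrite hornerMXaddC.
by apply: cvgD_at; [apply: cvgM_at; [exact: IH|exact: cvg_self]|exact: (cvg_cst_at z)].
Qed.

(** If [n < m], then [g = h (w-z)^(m-n)] near [z], and continuity gives [g z = 0]. Only [g] has to
    be nonzero at [z]. *)
Lemma pole_order_le f g (h : Cplx R -> Cplx R) z m n :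
  g w @[w --> z] --> g z -> h w @[w --> z] --> h z -> g z != 0 ->
  (\forall w \near z^', f w = g w / (w - z) ^+ m) ->
  (\forall w \near z^', f w = h w / (w - z) ^+ n) -> (m <= n)%N.
Proof.
move=> cg ch g0 fg fh; rewrite leqNgt; apply/negP => nm; move/eqP: g0; apply.
have e : \forall w \near z^', h w * (w - z) ^+ (m - n) = g w.
  near=> w.
  have wz : w - z != 0 by rewrite subr_eq0; near: w; exact: nbhs_dnbhs_neq.
  have : g w / (w - z) ^+ m = h w / (w - z) ^+ n.
    by rewrite -(near fg w) // -(near fh w).
  move/(congr1 (fun t => t * (w - z) ^+ m)); rewrite divfK ?expf_neq0 // => ->.
  by rewrite -{2}(subnK (ltnW nm)) exprD mulrACA mulVf ?expf_neq0 // mulr1.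
have l1 := cvg_dnbhs cg.
have l2 : (h w * (w - z) ^+ (m - n) : Cplx R) @[w --> z^'] --> (h z * (z - z) ^+ (m - n) : Cplx R).
  apply: cvg_dnbhs; apply: cvgM_at; first exact: ch.
  have : (w - z : Cplx R) @[w --> z] --> (z - z : Cplx R) by apply: cvgB_at; [exact: cvg_self|exact: (cvg_cst_at z)].
  elim: (m - n)%N => [|k IH] hz.
    by under eq_fun do rewrite expr0; rewrite expr0; exact: (cvg_cst_at z).
  under eq_fun do rewrite exprS; rewrite exprS.
  by apply: cvgM_at; [exact: hz|exact: IH].
have l3 : g w @[w --> z^'] --> (h z * (z - z) ^+ (m - n) : Cplx R).
  by apply: cvg_trans l2; exact: near_eq_cvg.
have -> := cvg_unique (@norm_hausdorff _ (Cplx R)) l1 l3.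
by rewrite subrr expr0n subn_eq0 leqNgt nm /= mulr0.
Unshelve. all: by end_near. Qed.

End PuncturedNeighborhoods.

(** * The meromorphic solution: poles, equation, transcendence *)

Section RiccatiSolution.
Variables (R : realType) (y : Cplx R -> Cplx R) (nu : nat -> R) (c d : R).
Hypothesis sol : solution_data y nu c d.
Implicit Types (z : Cplx R).

Local Notation f := (fun z : Cplx R => 1 - y (z + 1) / y z : Cplx R).

(** The multiplicity of [z] as a zero of [y], provided no factor of index at least [M] vanishes at
    [z]. *)
Definition zero_count M z := (\sum_(0 <= j < M) (1 + (nu j)%:C * z == 0)%R)%N.

Lemma nu_ge0 j : 0 <= nu j. Proof. by have /andP[] := sol_nu sol j. Qed.

Lemma nu_mul_lt1 (t : R) j : 0 <= t -> (Num.bound (c * t) <= j)%N -> nu j * t < 1.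
Proof.
move=> t0 Mj; have ct : 0 <= c * t by rewrite mulr_ge0 // ltW // (sol_c sol).
have /andP[_ nj] := sol_nu sol j.
apply: le_lt_trans (_ : c * t / j.+1%:R ^+ 2 < _).
  by rewrite mulrAC ler_wpM2r.
rewrite ltr_pdivrMr ?exprn_gt0 // mul1r.
apply: lt_le_trans (archi_boundP ct) _.
by rewrite -natrX ler_nat (leq_trans Mj) // (leq_trans (leqnSn j)) // expnS leq_pmulr // expn_gt0.
Qed.

Lemma nu_small (t : R) : 0 <= t -> exists M, forall j, (M <= j)%N -> nu j * t < 1.
Proof. by move=> t0; exists (Num.bound (c * t)) => j; exact: nu_mul_lt1. Qed.

Lemma factor_neq0 (t : R) j z : nc z <= t -> nu j * t < 1 -> 1 + (nu j)%:C * z != 0.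
Proof.
move=> zt nt; rewrite addr_eq0; apply/eqP => /(congr1 (@nc R)); rewrite nc1 ncN ncM nc_real.
rewrite ger0_norm ?nu_ge0 // => e; move: nt; rewrite ltNge {1}e.
by rewrite ler_wpM2l // nu_ge0.
Qed.

Lemma y_local_form z0 M : (forall j, (M <= j)%N -> 1 + (nu j)%:C * z0 != 0) ->
  exists H : Cplx R -> Cplx R, [/\ forall z, derivable H z 1, H z0 != 0 &
    forall z, y z = (z - z0) ^+ zero_count M z0 * H z].
Proof.
move=> hM; have [H [dH H0 Hy]] := sol_factor sol hM.
pose K : Cplx R := \prod_(0 <= j < M | 1 + (nu j)%:C * z0 == 0) (nu j)%:C.
have nj0 j : 1 + (nu j)%:C * z0 == 0 -> (nu j)%:C != 0 :> R[i].
  by move=> e; apply/eqP => n0; move: e; rewrite n0 mul0r addr0 oner_eq0.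
exists (fun z => K * H z); split.
- by move=> z; apply: derivableM; [exact: derivable_cst|exact: dH].
- rewrite mulf_neq0 // prodf_seq_neq0; apply/allP => j _; apply/implyP; exact: nj0.
- move=> z; rewrite Hy mulrA; congr (_ * _); rewrite /K /zero_count.
  elim: (index_iota 0 M) => [|j r IH]; first by rewrite !big_nil expr0 mul1r.
  rewrite !big_cons; case: ifP => [e|_]; last by rewrite add0n.
  rewrite IH /= exprS mulrACA; congr (_ * _).
  have -> : 1 = - ((nu j)%:C * z0) by apply/eqP; rewrite -addr_eq0.
  by rewrite mulrC; ring.
Qed.

Lemma y_near_neq0 z0 : \forall z \near z0^', y z != 0.
Proof.
have [M hM] := nu_small (nc_ge0 z0).
have [H [dH H0 Hy]] := y_local_form (fun j Mj => factor_neq0 (lexx _) (hM j Mj)).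
near=> z; rewrite Hy mulf_neq0 //.
  by rewrite expf_neq0 // subr_eq0; near: z; exact: nbhs_dnbhs_neq.
near: z; apply: nbhs_dnbhs; exact: cvgr_neq0 _ (derivable_cvg (dH z0)) H0.
Unshelve. all: by end_near. Qed.

Lemma y1_near_neq0 z0 : \forall z \near z0^', y (z + 1) != 0.
Proof.
have [M hM] := nu_small (nc_ge0 (z0 + 1)).
have [H [dH H0 Hy]] := y_local_form (fun j Mj => factor_neq0 (lexx _) (hM j Mj)).
near=> z; rewrite Hy mulf_neq0 //.
  rewrite expf_neq0 // opprD addrACA subrr addr0 subr_eq0.
  by near: z; exact: nbhs_dnbhs_neq.
near: z; apply: nbhs_dnbhs.
exact: cvgr_neq0 _ (derivable_cvg (derivable_shift (dH (z0 + 1)))) H0.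
Unshelve. all: by end_near. Qed.

(** The numerator is [(y(z) - y(z+1))/H(z)]. At a zero of [y] it equals [-y(z0+1)/H(z0)], nonzero by
    [sol_zero]. *)
Lemma f_local_form z0 M : (forall j, (M <= j)%N -> 1 + (nu j)%:C * z0 != 0) ->
  exists g, [/\ holomorphic_near g z0,
    (0 < zero_count M z0)%N -> g z0 != 0 &
    \forall z \near z0^', f z = g z / (z - z0) ^+ zero_count M z0].
Proof.
move=> hM; have [H [dH H0 Hy]] := y_local_form hM.
set n := zero_count M z0 in Hy *.
exists (fun z => (y z - y (z + 1)) / H z); split.
- have Hn := cvgr_neq0 _ (derivable_cvg (dH z0)) H0.
  near=> z; have Hz : H z != 0 by near: z; exact: Hn.
  apply: derivableM.
    by apply: derivableB; [|apply: derivable_shift]; exact: sol_der sol _.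
  exact: derivableV.
- move=> n0; have y0 : y z0 = 0 by rewrite Hy subrr expr0n gtn_eqF // mul0r.
  by rewrite y0 sub0r mulf_neq0 ?invr_eq0 // oppr_eq0 (sol_zero sol).
- near=> z.
  have yz : y z != 0 by near: z; exact: y_near_neq0.
  have zz : (z - z0) ^+ n != 0.
    by rewrite expf_neq0 // subr_eq0; near: z; exact: nbhs_dnbhs_neq.
  have Hz : H z != 0 by move: yz; rewrite Hy mulf_eq0 negb_or => /andP[].
  rewrite -mulrA -invfM (mulrC (H z)) -Hy.
  by rewrite mulrBl divff.
Unshelve. all: by end_near. Qed.

Lemma f_meromorphic : meromorphic f.
Proof.
move=> z0; have [M hM] := nu_small (nc_ge0 z0).
have [g [hg _ fg]] := f_local_form (fun j Mj => factor_neq0 (lexx _) (hM j Mj)).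
by exists (zero_count M z0), g.
Qed.

Lemma f_pole_order z0 M : (forall j, (M <= j)%N -> 1 + (nu j)%:C * z0 != 0) ->
  pole_order f z0 = zero_count M z0.
Proof.
move=> hM; have [g [hg g0 fg]] := f_local_form hM.
set n := zero_count M z0 in g0 fg *.
have cg : g w @[w --> z0] --> g z0 by apply: derivable_cvg; exact: nbhs_singleton hg.
have uniq m : pole_of_order f z0 m -> m = n.
  move=> [m0 [h [hh h0 fh]]].
  have ch : h w @[w --> z0] --> h z0 by apply: derivable_cvg; exact: nbhs_singleton hh.
  have mn := pole_order_le ch cg h0 fh fg.
  apply/eqP; rewrite eqn_leq mn /=.
  (* From [0 < m <= n] the point is a zero of [y], hence [g z0 != 0]. *)
  by apply: (pole_order_le cg ch (g0 (leq_trans m0 mn)) fg fh).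
rewrite /pole_order; have [n0|n0] := posnP n.
  rewrite n0; apply: xgetPN => m /= pm.
  by have := uniq _ pm; case: pm => m0 _ mn; move: m0; rewrite mn n0.
have pn : pole_of_order f z0 n by split=> //; exists g; split=> //; exact: g0.
by apply: xget_unique.
Qed.

Lemma f_riccati :
  meq (fun z => f (z + 1)) (fun z => (f z + (- 1 / (z + 2))) / (1 - f z)).
Proof.
move=> z0; near=> z.
have y0 : y z != 0 by near: z; exact: y_near_neq0.
have y1 : y (z + 1) != 0 by near: z; exact: y1_near_neq0.
have z2 : z + 2 != 0.
  by rewrite addr_eq0; near: z; exact: dnbhs_neq.
have h := sol_rec sol z; rewrite -(addrA z 1 1) (_ : 1 + 1 = 2 :> Cplx R) //.
have -> : y (z + 2) = 2 * y (z + 1) - (z + 1) / (z + 2) * y z.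
  apply: (mulfI z2); apply/eqP; rewrite -subr_eq0 -[X in _ == X]h; apply/eqP.
  by field.
have e : 1 - (1 - y (z + 1) / y z) = y (z + 1) / y z by ring.
by rewrite e; field; rewrite y0 y1 z2.
Unshelve. all: by end_near. Qed.

(** Every pole [-1/nu_j] would be a root of the denominator [q]. The roots of [q] are bounded,
    whereas [sol_large] gives nonzero [nu_j] of arbitrarily large index and hence poles of
    arbitrarily large modulus. *)
Lemma f_transcendental : transcendental f.
Proof.
move=> [p [q [q0 fpq]]].
have root_q j : 0 < nu j -> q.[- ((nu j)^-1)%:C] = 0.
  move=> nj; set z0 : Cplx R := - ((nu j)^-1)%:C.
  have [M hM] := nu_small (nc_ge0 z0).
  have hM' := fun j Mj => factor_neq0 (lexx _) (hM j Mj).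
  have [g [hg g0 fg]] := f_local_form hM'.
  have ej : 1 + (nu j)%:C * z0 = 0.
    by rewrite /z0 mulrN -rmorphM mulfV ?gt_eqF // rmorph1 subrr.
  have jM : (j < M)%N by rewrite ltnNge; apply/negP => /hM'; rewrite ej eqxx.
  have n0 : (0 < zero_count M z0)%N.
    by rewrite /zero_count (big_rem j) ?mem_index_iota //= ej eqxx.
  have cg : g w @[w --> z0] --> g z0 by apply: derivable_cvg; exact: nbhs_singleton hg.
  set n := zero_count M z0 in g0 fg n0 *.
  (* Clearing denominators with [q^2] instead of [q] makes both sides vanish wherever [q] does. At
     [z0] the left side is 0 and [g z0 != 0], so [q] vanishes there. *)
  pose P : Cplx R -> Cplx R := fun w => (p * q * ('X - z0%:P) ^+ n).[w].
  pose Q : Cplx R -> Cplx R := fun w => g w * (q ^+ 2).[w].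
  have cP : P w @[w --> z0^'] --> P z0 by apply: cvg_dnbhs; exact: cvg_horner.
  have cQ : Q w @[w --> z0^'] --> Q z0.
    by apply: cvg_dnbhs; apply: cvgM_at; [exact: cg|exact: cvg_horner].
  have e : \forall w \near z0^', P w = Q w.
    near=> w; rewrite /P /Q.
    have wz : (w - z0) ^+ n != 0.
      by rewrite expf_neq0 // subr_eq0; near: w; exact: nbhs_dnbhs_neq.
    have : p.[w] / q.[w] = g w / (w - z0) ^+ n.
      by rewrite -(near (fpq z0) w) // -(near fg w).
    rewrite !hornerM !horner_exp hornerXsubC.
    have [->|qw] := eqVneq q.[w] 0; first by rewrite !(mulr0, mul0r).
    move=> /(congr1 (fun t => t * (q.[w] ^+ 2 * (w - z0) ^+ n))) h.
    transitivity (p.[w] / q.[w] * (q.[w] ^+ 2 * (w - z0) ^+ n)); first by field.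
    by rewrite h; field.
  have cP' : P w @[w --> z0^'] --> Q z0.
    by apply: cvg_trans cQ; apply: near_eq_cvg; near=> w; rewrite (near e w).
  have : P z0 = Q z0 by apply: (cvg_unique (@norm_hausdorff _ (Cplx R)) cP cP').
  rewrite /P /Q !hornerM !horner_exp hornerXsubC subrr expr0n (gtn_eqF n0) mulr0.
  by move=> /esym/eqP; rewrite mulf_eq0 (negbTE (g0 n0)) /= mulf_eq0 orbb => /eqP.
have [r er] := closed_field_poly_normal q.
pose B := \sum_(w <- r) nc w.
have B0 : 0 <= B by apply: sumr_ge0 => w _; exact: nc_ge0.
have rB w : root q w -> nc w <= B.
  rewrite er rootZ ?lead_coef_eq0 // root_prod_XsubC => wr.
  by rewrite /B (big_rem _ wr) /= lerDl sumr_ge0 // => v _; exact: nc_ge0.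
have [j Jj dj] := sol_large sol (Num.bound (c * B)).
have nj : 0 < nu j by apply: lt_le_trans dj; rewrite divr_gt0 ?exprn_gt0 // (sol_d sol).
have := rB (- ((nu j)^-1)%:C); rewrite /root root_q // eqxx ncN nc_real => /(_ isT).
rewrite ger0_norm ?invr_ge0 ?nu_ge0 //.
apply/negP; rewrite -ltNge.
by rewrite -[ltRHS]mul1r ltr_pdivlMr // mulrC nu_mul_lt1.
Unshelve. all: by end_near. Qed.

End RiccatiSolution.


(* Unlike [ge0_le_integral], this needs no measurability: the integral of a
   nonnegative function is a supremum over the simple functions below it. *)
Lemma ge0_le_integral_dom d (T : measurableType d) (R : realType)
    (m : {measure set T -> \bar R}) (D1 D2 : set T) (f1 f2 : T -> \bar R) :
  (forall x, D1 x -> 0 <= f1 x)%E -> (forall x, D2 x -> 0 <= f2 x)%E ->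
  (forall x, D1 x -> D2 x /\ (f1 x <= f2 x)%E) ->
  (\int[m]_(x in D1) f1 x <= \int[m]_(x in D2) f2 x)%E.
Proof.
move=> f10 f20 f12; rewrite (integral_mkcond D1) (integral_mkcond D2).
rewrite !ge0_integralTE; [|by move=> x; apply: erestrict_ge0..].
apply: ereal_sup_le => _ [h hle <-]; exists h => //= x.
apply: le_trans (hle x) _; rewrite /patch; case: ifPn => [|_].
  by rewrite inE => /f12[D2x ?]; rewrite mem_set.
by case: ifPn => //; rewrite inE => /f20.
Qed.

(** * An integrable majorant of the inverse square root *)

Section InverseSqrtMajorant.
Variables (R : realType) (a r : R).
Hypothesis r0 : 0 < r.

Let ball_ k : set R := `[a - r / 4 ^+ k, a + r / 4 ^+ k].
Let coef k : R := 2 ^+ k.+1 / Num.sqrt r.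

(* On the dyadic annulus r/4^(k+1) < |t-a| <= r/4^k the k-th term dominates
   |t-a|^(-1/2). *)
Definition isqrt_majorant (t : R) : \bar R :=
  (\sum_(k <oo) (coef k)%:E * (\1_(ball_ k) t)%:E)%E.

Let sr0 : 0 < Num.sqrt r. Proof. by rewrite sqrtr_gt0. Qed.

Let coef_ge0 k : 0 <= coef k.
Proof. by rewrite divr_ge0 ?exprn_ge0 // ltW. Qed.

Let term_ge0 k t : (0 <= (coef k)%:E * (\1_(ball_ k) t)%:E)%E.
Proof. by rewrite mule_ge0 // lee_fin. Qed.

Lemma isqrt_majorant_ge0 t : (0 <= isqrt_majorant t)%E.
Proof. by apply: nneseries_ge0 => k _ _; exact: term_ge0. Qed.

Let term_measurable k D : measurable_fun D ((fun t => (coef k)%:E * (\1_(ball_ k) t)%:E)%E : R -> \bar R).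
Proof.
apply: measurable_funTS; apply: measurable_funeM; apply/measurable_EFinP.
by apply: measurable_indic; exact: measurable_itv.
Qed.

Lemma measurable_isqrt_majorant D : measurable_fun D isqrt_majorant.
Proof.
apply: measurable_funTS.
by apply: (@ge0_emeasurable_sum _ _ _ setT _ xpredT) => // k t _ _; exact: term_ge0.
Qed.

Lemma isqrt_majorant_ge k t : `|t - a| <= r / 4 ^+ k -> ((coef k)%:E <= isqrt_majorant t)%E.
Proof.
move=> tk; apply: le_trans (nneseries_lim_ge k.+1 _); last by move=> n _ _; exact: term_ge0.
rewrite big_nat_recr //= -[leLHS]add0e; apply: leeD; first by apply: sume_ge0 => i _; exact: term_ge0.
rewrite indicE mem_set ?mule1 // /ball_ /= in_itv /=.
by move: tk; rewrite ler_distl.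
Qed.

Lemma isqrt_majorantE t : 0 < `|t - a| -> `|t - a| <= r ->
  ((Num.sqrt `|t - a|^-1)%:E <= isqrt_majorant t)%E.
Proof.
set x := `|t - a| => x0 xr.
have [n hn] : exists n, r / 4 ^+ n < x.
  exists (Num.bound (r / x)); have rx : 0 <= r / x by rewrite divr_ge0 // ltW.
  rewrite ltr_pdivrMr ?exprn_gt0 // mulrC -ltr_pdivrMr //.
  apply: lt_le_trans (archi_boundP rx) _.
  by rewrite -natrX ler_nat ltnW // ltn_expl.
have [k hk kmin] := ex_minnP (ex_intro (fun n => r / 4 ^+ n < x) n hn).
case: k hk kmin => [|k] hk kmin.
  by move: hk; rewrite expr0 divr1 ltNge xr.
have xk : x <= r / 4 ^+ k by rewrite leNgt; apply/negP => /kmin; rewrite ltnn.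
apply: le_trans (isqrt_majorant_ge xk); rewrite lee_fin.
rewrite -[leRHS]ger0_norm ?coef_ge0 // -sqrtr_sqr ler_sqrt ?sqr_ge0 //.
rewrite /coef expr_div_n (sqr_sqrtr (ltW r0)) -exprM mulnC exprM.
have -> : 2 ^+ 2 = 4 :> R by rewrite expr2; ring.
rewrite -[leRHS]invrK lef_pV2 ?posrE ?invr_gt0 ?divr_gt0 ?exprn_gt0 //.
by rewrite invf_div; exact: ltW.
Qed.

(** The infinite value at the centre makes domination hold at the singular point, whatever the
    dominated function is there. *)
Lemma isqrt_majorant_center : isqrt_majorant a = +oo%E.
Proof.
apply/eqyP => A A0.
apply: le_trans (isqrt_majorant_ge (k := Num.bound (A * Num.sqrt r)) _); last first.
  by rewrite subrr normr0 divr_ge0 ?exprn_ge0 // ltW.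
rewrite lee_fin /coef ler_pdivlMr //.
have As : 0 <= A * Num.sqrt r by rewrite mulr_ge0 // ltW.
apply: le_trans (ltW (archi_boundP As)) _.
by rewrite -natrX ler_nat (leq_trans (ltnW (ltn_expl _ (ltnSn 1)))) // leq_pexp2l.
Qed.

(** The [k]-th term integrates to [2^(k+1)/sqrt r * 2 r/4^k = 8 sqrt r/2^(k+1)], a geometric
    series. *)
Lemma integral_isqrt_majorant :
  (\int[lebesgue_measure]_(t in setT) isqrt_majorant t <= (8 * Num.sqrt r)%:E)%E.
Proof.
rewrite integral_nneseries; [|exact: measurableT|by move=> k; exact: term_measurable|
  by move=> k t _; exact: term_ge0].
apply: le_trans (@epsilon_trick0 R (8 * Num.sqrt r) xpredT _); last first.
  by rewrite mulr_ge0 // ltW.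
apply: lee_nneseries => [k *|k *]; first by apply: integral_ge0 => t _; exact: term_ge0.
rewrite ge0_integralZl_EFin; [|exact: measurableT|by move=> t _; rewrite lee_fin| |exact: coef_ge0].
  rewrite integral_indic ?setIT; [|exact: measurableT|exact: measurable_itv].
  rewrite /ball_ /= lebesgue_measure_itv /= lte_fin.
  have rk : 0 < r / 4 ^+ k by rewrite divr_gt0 ?exprn_gt0.
  rewrite ifT; last by rewrite ltrBlDr -addrA ltrDl addr_gt0.
  rewrite -EFinB -EFinM lee_fin le_eqVlt; apply/orP; left; apply/eqP.
  have -> : a + r / 4 ^+ k - (a - r / 4 ^+ k) = 2 * (r / 4 ^+ k) by ring.
  rewrite /coef; move: (Num.sqrt r) (sqr_sqrtr (ltW r0)) sr0 => s <- s0.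
  have -> : 4 ^+ k = 2 ^+ k * 2 ^+ k :> R by rewrite -exprMn; congr (_ ^+ _); ring.
  rewrite natrX exprS; have t0 : 2 ^+ k != 0 :> R by rewrite expf_neq0.
  by field; rewrite t0 gt_eqF.
by apply/measurable_EFinP; apply: measurable_indic; exact: measurable_itv.
Qed.

End InverseSqrtMajorant.

(** * Linear lower bound for the sine *)

Section SineLowerBound.
Variable R : realType.

(** On [[0, 1]] the mean value theorem gives slope [cos 1]. Beyond 1, [sin x >= sin 1 >= cos 1], and
    [x <= pi/2 < 2] explains the factor 1/2. *)
Lemma sin_ge_linear (x : R) : 0 <= x <= pi / 2 -> cos 1 / 2 * x <= sin x.
Proof.
move=> /andP[x0 x2].
have c1 := @cos1_gt0 R.
have small (u : R) : 0 <= u <= 1 -> cos 1 * u <= sin u.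
  move=> /andP[u0 u1]; have [->|un0] := eqVneq u 0; first by rewrite mulr0 sin0.
  have up : 0 < u by rewrite lt_def un0.
  have [|v v01 e] := @MVT R sin cos 0 u up (fun x _ => is_derive_sin x).
    by apply: continuous_subspaceT => ?; exact: continuous_sin.
  move: e; rewrite sin0 !subr0 => ->; rewrite ler_wpM2r //.
  move: v01; rewrite in_itv /= => /andP[v0 vu].
  have pi2 := @pi_ge2 R.
  rewrite leNgt ltr_cos ?in_itv /=; [|lra..].
  by rewrite -leNgt; lra.
have [x1|x1] := leP x 1.
  apply: le_trans (small _ _); last by rewrite x0.
  by rewrite ler_wpM2r //; lra.
have s1 := small 1 (introT andP (conj ler01 (lexx 1))).
have p1 := @pihalf_ge1 R; have p2 := @pihalf_lt2 R.
apply: le_trans (_ : sin 1 <= _); last first.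
  rewrite ltW // ltr_sin // ?in_itv /=; lra.
apply: le_trans s1; rewrite mulr1; nra.
Qed.

Lemma normr_sin_ge (x : R) : `|x| <= pi / 2 -> cos 1 / 2 * `|x| <= `|sin x|.
Proof.
move=> xp; have h := @sin_ge_linear `|x|.
rewrite -(ger0_norm (normr_ge0 x)) in h *.
apply: le_trans (h _) _; first by rewrite normr_id normr_ge0.
rewrite normr_id; have [x0|x0] := leP 0 x; first by rewrite ger0_norm // ler_norm.
by rewrite ltr0_norm // sinN -normrN ler_norm.
Qed.

Lemma normr_sin_shift (x : R) : `|sin (x - pi)| = `|sin x|.
Proof. by rewrite -[in RHS](subrK pi x) sinDpi normrN. Qed.

Lemma normr_sin_near (t : R) : 0 <= t <= 2 * pi ->
  exists2 k : nat, (k < 3)%N &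
    `|t - k%:R * pi| <= 2 * pi /\ cos 1 / 2 * `|t - k%:R * pi| <= `|sin t|.
Proof.
move=> /andP[t0 t2]; have p0 := @pi_gt0 R.
have H k : `|sin (t - k%:R * pi)| = `|sin t|.
  elim: k => [|k IH]; first by rewrite mul0r subr0.
  by rewrite -natr1 mulrDl mul1r opprD addrA normr_sin_shift.
have near k : `|t - k%:R * pi| <= pi / 2 ->
    `|t - k%:R * pi| <= 2 * pi /\ cos 1 / 2 * `|t - k%:R * pi| <= `|sin t|.
  move=> hk; split; first by apply: le_trans hk _; lra.
  by rewrite -(H k) normr_sin_ge.
have [h1|h1] := leP t (pi / 2).
  by exists 0%N => //; apply: near; rewrite mul0r subr0 ger0_norm.
have [h2|h2] := leP t (3 * pi / 2).
  by exists 1%N => //; apply: near; rewrite mul1r ler_norml; lra.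
by exists 2%N => //; apply: near; rewrite ler_norml; lra.
Qed.

End SineLowerBound.


(** * Bounds for the counting and proximity functions *)

Section NevanlinnaBounds.
Variables (R : realType) (y : Cplx R -> Cplx R) (nu : nat -> R) (c d : R).
Hypothesis sol : solution_data y nu c d.
Implicit Types (z : Cplx R).

Local Notation f := (fun z : Cplx R => 1 - y (z + 1) / y z : Cplx R).

Let c0 : 0 < c := sol_c sol.
Let nu0 j : 0 <= nu j := nu_ge0 sol j.

(** A factor has at most the zero [-1/nu_j]. Counting factor by factor takes care of multiplicities
    without deciding which zeros coincide. *)
Lemma esum_factor (t : R) j : 0 <= t ->
  (\esum_(z in [set z : Cplx R | (nc z <= t)%R]) ((1 + (nu j)%:C * z == 0)%R%:R)%:E =
   ((1 <= nu j * t)%R%:R)%:E :> \bar R)%E.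
Proof.
move=> t0; have [nj|nj] := eqVneq (nu j) 0.
  rewrite nj mul0r ler10 /=; apply: esum1 => z _.
  by rewrite rmorph0 mul0r addr0 oner_eq0.
have nj0 : 0 < nu j by rewrite lt_def nj nu0.
have njC : (nu j)%:C != 0 :> R[i] by rewrite realC_eq0.
pose w : Cplx R := - ((nu j)^-1)%:C.
have wE z : (1 + (nu j)%:C * z == 0) = (z == w).
  rewrite addrC addr_eq0; apply/eqP/eqP => [h|->].
    by apply: (mulfI njC); rewrite h /w mulrN -rmorphM mulfV // rmorph1.
  by rewrite /w mulrN -rmorphM mulfV // rmorph1.
have wt : (nc w <= t) = (1 <= nu j * t).
  by rewrite /w ncN nc_real ger0_norm ?invr_ge0 // -[leLHS]mul1r ler_pdivrMr // mulrC.
rewrite (esumID [set w]); last by move=> z _; rewrite lee_fin.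
rewrite [X in (_ + X)%E]esum1 ?adde0; last first.
  by move=> z [_ /eqP]; rewrite wE => /negbTE ->.
rewrite -wt.
have [wS|wS] := boolP (nc w <= t).
  rewrite (_ : _ `&` _ = [set w]); last by apply/seteqP; split => [z []//|z ->]; split.
  by rewrite esum_set1 wE eqxx ?lee_fin.
rewrite (_ : _ `&` _ = set0) ?esum_set0 //.
by apply/seteqP; split => // z [/= zt zw]; move: wS; rewrite -zw zt.
Qed.

Lemma pole_countE (t : R) M : 0 <= t -> (forall j, (M <= j)%N -> nu j * t < 1) ->
  pole_count f t = ((\sum_(0 <= j < M) (1 <= nu j * t)%R)%N%:R)%:E.
Proof.
move=> t0 hM; rewrite /pole_count.
transitivity (\esum_(z in [set z : Cplx R | (nc z <= t)%R])
    \sum_(0 <= j < M) ((1 + (nu j)%:C * z == 0)%R%:R)%:E : \bar R)%E.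
  apply: eq_esum => z /= zt; rewrite (f_pole_order sol (M := M)) /zero_count.
    by rewrite natr_sum sumEFin.
  by move=> j Mj; apply: (factor_neq0 sol zt); exact: hM.
rewrite esum_sum; last by move=> z j _ _; rewrite lee_fin.
by rewrite natr_sum -sumEFin; apply: eq_bigr => j _; exact: esum_factor.
Qed.

Lemma pole_count0 : pole_count f 0 = 0%E.
Proof.
by rewrite (@pole_countE 0 0) // ?big_geq // => j _; rewrite mulr0 ltr01.
Qed.

Lemma pole_count_ge (t : R) j : 0 <= t -> 1 <= nu j * t ->
  ((j.+1%:R)%:E <= pole_count f t)%E.
Proof.
move=> t0 jt; have [M hM] := nu_small sol t0.
rewrite (pole_countE t0 hM) lee_fin ler_nat.
have jM : (j < M)%N by rewrite ltnNge; apply/negP => /hM; rewrite ltNge jt.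
rewrite (big_cat_nat (leq0n j.+1) jM) /= (leq_trans _ (leq_addr _ _)) //.
rewrite (@eq_big_nat _ _ _ 0 j.+1 _ (fun=> 1%N)); last first.
  move=> i /andP[_ ij]; suff -> : 1 <= nu i * t by [].
  by apply: le_trans jt _; rewrite ler_wpM2r // (sol_mono sol).
by rewrite sum_nat_const_nat subn0 muln1.
Qed.

(** A counted index satisfies [1 <= nu_j t <= c t/(j+1)^2], that is [j+1 <= sqrt(c t)]. *)
Lemma pole_count_le (t : R) : 0 <= t -> (pole_count f t <= (Num.sqrt (c * t))%:E)%E.
Proof.
move=> t0; have [M hM] := nu_small sol t0.
rewrite (pole_countE t0 hM) lee_fin.
set x := Num.sqrt (c * t); have x0 : 0 <= x by exact: sqrtr_ge0.
have ct : 0 <= c * t by rewrite mulr_ge0 // ltW.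
have /andP[k1 k2] := truncn_itv x0; set k := Num.truncn x in k1 k2.
apply: le_trans k1; rewrite ler_nat.
apply: leq_trans (_ : \sum_(0 <= j < M) (j < k) <= _)%N.
  apply: leq_sum => j _; have [jt|//] := boolP (1 <= nu j * t).
  have /andP[_ nj] := sol_nu sol j.
  have jx : j.+1%:R <= x.
    rewrite -(ger0_norm (ler0n R j.+1)) -sqrtr_sqr ler_sqrt //.
    rewrite -[leLHS]mul1r -ler_pdivlMr ?exprn_gt0 //.
    by apply: le_trans jt _; rewrite mulrAC ler_wpM2r.
  have := le_lt_trans jx k2; rewrite ltr_nat ltnS => jk.
  by rewrite jk.
suff -> : (\sum_(0 <= j < M) (j < k))%N = minn M k by exact: geq_minr.
elim: M {hM} => [|M IH]; first by rewrite big_geq // min0n.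
rewrite big_nat_recr //= IH /minn; case: (ltnP M k) => h1; case: (ltnP M.+1 k) => h2 /=; lia.
Qed.

Let pole_count_ge0 t : (0 <= pole_count f t)%E.
Proof. by apply: esum_ge0 => z _; rewrite lee_fin. Qed.

Lemma counting_funE (r : R) : counting_fun f r =
  (\int[lebesgue_measure]_(t in `]0%R, r]) (pole_count f t * (t^-1)%:E))%E.
Proof.
rewrite /counting_fun pole_count0 mul0e adde0.
by apply: eq_integral => t _; rewrite sube0.
Qed.

Let integrand_ge0 r t : `]0%R, r] t -> (0 <= pole_count f t * (t^-1)%:E)%E.
Proof.
rewrite /= in_itv /= => /andP[t0 _].
by rewrite mule_ge0 ?pole_count_ge0 // lee_fin invr_ge0 ltW.
Qed.

Lemma counting_fun_ge0 (r : R) : (0 <= counting_fun f r)%E.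
Proof. by rewrite counting_funE; apply: integral_ge0 => t; exact: integrand_ge0. Qed.

Lemma counting_fun_le (r : R) : 0 < r ->
  (counting_fun f r <= (8 * Num.sqrt c * Num.sqrt r)%:E)%E.
Proof.
move=> r0; rewrite counting_funE.
have sc : 0 <= Num.sqrt c by exact: sqrtr_ge0.
apply: le_trans (_ : (\int[lebesgue_measure]_(t in setT)
    ((Num.sqrt c)%:E * isqrt_majorant 0 r t) <= _)%E); last first.
  rewrite ge0_integralZl_EFin //; last first.
  - exact: measurable_isqrt_majorant.
  - by move=> t _; exact: isqrt_majorant_ge0.
  apply: le_trans (lee_wpmul2l _ (integral_isqrt_majorant 0 r0)) _; first by rewrite lee_fin.
  by rewrite -EFinM lee_fin mulrA (mulrC (Num.sqrt c)).
apply: ge0_le_integral_dom => [t|t _|t].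
- exact: integrand_ge0.
- by rewrite mule_ge0 ?lee_fin //; exact: isqrt_majorant_ge0.
rewrite /= in_itv /= => /andP[t0 tr]; split=> //.
apply: le_trans (_ : (Num.sqrt (c * t))%:E * (t^-1)%:E <= _)%E.
  by rewrite lee_wpmul2r ?pole_count_le ?lee_fin ?invr_ge0 // ltW.
have -> : ((Num.sqrt (c * t))%:E * (t^-1)%:E = (Num.sqrt c)%:E * (Num.sqrt t^-1)%:E)%E.
  rewrite -!EFinM (sqrtrM _ (ltW c0)) -mulrA; congr (_ * _)%:E.
  rewrite sqrtrV ?ltW // -{2}(sqr_sqrtr (ltW t0)); field.
  by rewrite gt_eqF // sqrtr_gt0.
rewrite lee_wpmul2l ?lee_fin //.
have := @isqrt_majorantE R 0 r r0 t; rewrite subr0 gtr0_norm //; exact.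
Qed.

(** On [[s, 2s]] with [s = 1/nu_j], at least [j+1] poles are counted and [1/t >= 1/(2s)]. *)
Lemma counting_fun_ge j : 0 < nu j ->
  ((j.+1%:R / 2)%:E <= counting_fun f (2 / nu j))%E.
Proof.
move=> nj; rewrite counting_funE; set s := (nu j)^-1.
have s0 : 0 < s by rewrite invr_gt0.
pose D : set R := `[s, 2 * s].
pose e : \bar R := (j.+1%:R / (2 * s))%:E.
apply: le_trans (_ : (\int[lebesgue_measure]_(t in D) (cst e t) <= _)%E); last first.
  apply: ge0_le_integral_dom => [t _|t|t].
  - by rewrite /e lee_fin divr_ge0 // mulr_ge0 // ltW.
  - exact: integrand_ge0.
  rewrite /= !in_itv /= => /andP[st t2]; have t0 := lt_le_trans s0 st.
  split; first by rewrite t0.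
  rewrite /= /e EFinM lee_pmul ?lee_fin ?invr_ge0 ?mulr_ge0 // ?(ltW s0) //.
    apply: pole_count_ge; first exact: ltW.
    by rewrite mulrC -ler_pdivrMr // mul1r; exact: st.
  by rewrite lef_pV2 ?posrE ?mulr_gt0 //; exact: t2.
rewrite integral_cst; last exact: measurable_itv.
rewrite /= /D lebesgue_measure_itv /= lte_fin ifT; last by rewrite ltr_pMl // ltr1n.
rewrite /e -EFinB -EFinM lee_fin le_eqVlt; apply/orP; left; apply/eqP; field.
by rewrite gt_eqF.
Qed.

(** [sol_shift] applies with [s = |sin t|], because [|1 + u r e^(it)|^2 - sin^2 t = (u r + cos
    t)^2]. The bound is therefore independent of [r]. *)
Lemma lnp_circle (r t : R) : sin t != 0 ->
  lnp (nc (f (circle_point r t))) <= 7 + 5 * Num.sqrt c * Num.sqrt `|sin t|^-1.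
Proof.
move=> st; set z := circle_point r t.
have s0 : 0 < `|sin t| by rewrite normr_gt0.
have sz (u : R) : 0 <= u -> `|sin t| <= nc (1 + u%:C * z).
  move=> u0; have -> : 1 + u%:C * z = ((1 + u * r * cos t) +i* (u * r * sin t))%C.
    rewrite /z /circle_point; apply/eqP; rewrite eq_complex /=.
    by rewrite !mul0r subr0 add0r addr0 !mulrA !eqxx.
  rewrite -(@ler_pXn2r _ 2) ?nnegrE ?nc_ge0 // nc_sqr /= real_normK ?num_real //.
  have h := cos2Dsin2 t; rewrite -subr_ge0.
  have -> : (1 + u * r * cos t) ^+ 2 + (u * r * sin t) ^+ 2 - sin t ^+ 2 =
     (u * r + cos t) ^+ 2.
    have -> : (1 + u * r * cos t) ^+ 2 + (u * r * sin t) ^+ 2 - sin t ^+ 2 =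
      1 + 2 * (u * r * cos t) + (u * r) ^+ 2 * (cos t ^+ 2 + sin t ^+ 2) - sin t ^+ 2 by ring.
    by rewrite h -{1}h; ring.
  exact: sqr_ge0.
have := sol_shift sol s0 sz.
have -> : Num.sqrt (c / `|sin t|) = Num.sqrt c * Num.sqrt `|sin t|^-1.
  by rewrite sqrtrM // ltW.
set X := 5 * _ => hy.
have X0 : 0 <= X by rewrite mulr_ge0 // addr_ge0 // mulr_ge0 ?sqrtr_ge0.
have fX : nc (f z) <= 2 * expR X.
  apply: le_trans (ncB _ _) _; rewrite nc1 ncM ncV.
  have e1 : 1 <= expR X by have := expR_ge1Dx X; lra.
  suff : nc (y (z + 1)) / nc (y z) <= expR X by lra.
  have [y0|y0] := eqVneq (nc (y z)) 0; first by rewrite y0 invr0 mulr0 expR_ge0.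
  by rewrite ler_pdivrMr ?lt_def ?y0 ?nc_ge0 // mulrC.
rewrite /lnp ge_max; apply/andP; split.
  by rewrite addr_ge0 // !mulr_ge0 ?sqrtr_ge0.
(* The 5 comes from [sol_shift]; the 2 bounds [ln 2], from [1 + e^X <= 2 e^X]. *)
have -> : 7 + 5 * Num.sqrt c * Num.sqrt `|sin t|^-1 = 2 + X by rewrite /X; ring.
have [f0|f0] := leP (nc (f z)) 0; first by rewrite ln0 // addr_ge0.
apply: le_trans (_ : ln (2 * expR X) <= _).
  by rewrite ler_ln ?posrE ?mulr_gt0 ?expR_gt0.
rewrite lnM ?posrE ?expR_gt0 // expRK lerD2r.
by rewrite ltW // ln_sublinear.
Qed.

Lemma proximity_fun_ge0 (r : R) : (0 <= proximity_fun f r)%E.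
Proof.
rewrite /proximity_fun mule_ge0 ?lee_fin ?invr_ge0 ?mulr_ge0 ?pi_ge0 //.
by apply: integral_ge0 => t _; rewrite lee_fin /lnp le_max lexx.
Qed.

Lemma proximity_fun_le : exists P : R, forall r, (proximity_fun f r <= P%:E)%E.
Proof.
have p2 : 0 < 2 * pi :> R by rewrite mulr_gt0 // pi_gt0.
have c1 : 0 < cos 1 / 2 :> R by rewrite divr_gt0 // cos1_gt0.
pose K := 5 * Num.sqrt c * Num.sqrt (cos 1 / 2)^-1.
have K0 : 0 < K by rewrite !mulr_gt0 ?sqrtr_gt0 ?invr_gt0.
(* One majorant for each zero 0, [pi], [2 pi] of the sine on the circle of integration, of radius
   [2 pi] so that each covers the whole interval. *)
pose m k := isqrt_majorant (k%:R * pi) (2 * pi) : R -> \bar R.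
pose G t := (m 0%N t + (m 1%N t + m 2%N t))%E.
have m0 k t : (0 <= m k t)%E by exact: isqrt_majorant_ge0.
have mm k D : measurable_fun D (m k) by exact: measurable_isqrt_majorant.
have G0 t : (0 <= G t)%E by rewrite !adde_ge0.
have mG D : measurable_fun D G by do 2 (apply: emeasurable_funD => //).
pose I : set R := `[0, 2 * pi].
have mI : measurable I by exact: measurable_itv.
have intm k : (\int[lebesgue_measure]_(t in I) m k t <= (8 * Num.sqrt (2 * pi))%:E)%E.
  apply: le_trans (integral_isqrt_majorant (k%:R * pi) p2).
  by apply: ge0_le_integral_dom => // t _; exact: m0.
pose Q := (7 * (2 * pi) + K * (8 * Num.sqrt (2 * pi) *+ 3)).
exists ((2 * pi)^-1 * Q) => r; rewrite /proximity_fun EFinM.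
rewrite lee_wpmul2l ?lee_fin ?invr_ge0 ?(ltW p2) //.
apply: le_trans (_ : (\int[lebesgue_measure]_(t in I) (cst 7%:E t + K%:E * G t) <= _)%E); last first.
  have KG0 t : I t -> (0 <= K%:E * G t)%E by move=> _; rewrite mule_ge0 ?lee_fin // ltW.
  have mKG : measurable_fun I (fun t => K%:E * G t)%E by apply: measurable_funeM.
  have G12 t : I t -> (0 <= m 1%N t + m 2%N t)%E by move=> _; rewrite adde_ge0.
  have mG12 : measurable_fun I (fun t => m 1%N t + m 2%N t)%E by apply: emeasurable_funD.
  have intG : (\int[lebesgue_measure]_(t in I) G t <= (8 * Num.sqrt (2 * pi) *+ 3)%:E :> \bar R)%E.
    rewrite mulrS mulr2n !EFinD /G.
    rewrite ge0_integralD; [|exact: mI|by []|exact: mm|exact: G12|exact: mG12].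
    apply: leeD; first exact: intm.
    rewrite ge0_integralD; [|exact: mI|by []|exact: mm|by []|exact: mm].
    by apply: leeD; exact: intm.
  have int7 : (\int[lebesgue_measure]_(t in I) (cst 7%:E) t <= (7 * (2 * pi))%:E :> \bar R)%E.
    by rewrite integral_cst // /I /= lebesgue_measure_itv /= lte_fin p2 -EFinB subr0 EFinM.
  have -> : (Q%:E = (7 * (2 * pi))%:E + (K * (8 * Num.sqrt (2 * pi) *+ 3))%:E)%E by rewrite -EFinD.
  have e70 (t : R) : I t -> (0 <= (cst 7%:E : R -> \bar R) t)%E by move=> _; rewrite lee_fin.
  rewrite ge0_integralD //; apply: leeD; first exact: int7.
  rewrite ge0_integralZl_EFin; [|exact: mI|by move=> t _; exact: G0|exact: mG|exact: ltW].
  rewrite [leRHS]EFinM lee_wpmul2l ?lee_fin ?(ltW K0) //.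
apply: ge0_le_integral_dom => [t _|t _|t tI].
- by rewrite lee_fin /lnp le_max lexx.
- by rewrite adde_ge0 ?lee_fin // mule_ge0 ?lee_fin // ltW.
split=> //; move: tI; rewrite /= in_itv /= => /normr_sin_near[k k3 [h1 h2]].
have mG_le : (m k t <= G t)%E.
  case: k k3 {h1 h2} => [|[|[|//]]] _; rewrite /G.
  - by rewrite leeDl // adde_ge0.
  - by apply: le_trans (leeDr _ _); rewrite ?leeDl.
  - by apply: le_trans (leeDr _ _); rewrite ?leeDr.
(* At a zero of the sine the estimate of [f] says nothing, but the majorant is infinite. *)
have [tk|tk] := eqVneq (`|t - k%:R * pi|) 0.
  have tE : t = k%:R * pi by apply/eqP; rewrite -subr_eq0 -normr_eq0 tk.
  have -> : G t = +oo%E.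
    by apply/eqP; rewrite eq_le leey /= (le_trans _ mG_le) // /m tE isqrt_majorant_center.
  by rewrite gt0_muley ?lte_fin // addey // leey.
have tk0 : 0 < `|t - k%:R * pi| by rewrite lt_def tk normr_ge0.
have st : 0 < `|sin t| by apply: lt_le_trans h2; rewrite mulr_gt0.
apply: le_trans (_ : ((7 + 5 * Num.sqrt c * Num.sqrt `|sin t|^-1)%:E <= _)%E).
  by rewrite lee_fin lnp_circle // -normr_gt0.
rewrite EFinD leeD2l //.
apply: le_trans (_ : (K%:E * (Num.sqrt `|t - k%:R * pi|^-1)%:E <= _)%E); last first.
  rewrite lee_wpmul2l ?lee_fin ?(ltW K0) //; apply: le_trans mG_le.
  exact: isqrt_majorantE.
rewrite -EFinM lee_fin /K -[leRHS]mulrA ler_wpM2l ?mulr_ge0 ?sqrtr_ge0 //.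
rewrite -sqrtrM ?invr_ge0 ?(ltW c1) // ler_sqrt; last first.
  by rewrite mulr_ge0 ?invr_ge0 ?(ltW c1) ?(ltW tk0).
by rewrite -invfM lef_pV2 ?posrE // mulr_gt0.
Qed.

End NevanlinnaBounds.


(** * The order of growth and the conclusion *)

Section OrderOneHalf.
Variable R : realType.

Lemma ln_mul_sqrt (b r : R) : 0 < b -> 0 < r -> ln (b * Num.sqrt r) = ln b + ln r / 2.
Proof.
move=> b0 r0; have s0 : 0 < Num.sqrt r by rewrite sqrtr_gt0.
rewrite lnM ?posrE // -{2}(sqr_sqrtr (ltW r0)) lnXn // mulr2n.
by congr (_ + _); field.
Qed.

Lemma ln_ge_of_gt_expR (u r : R) : expR u < r -> u <= ln r.
Proof.
move=> ur; rewrite -[leLHS]expRK ler_ln ?posrE ?expR_gt0 ?(lt_trans (expR_gt0 u) ur) //.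
exact: ltW.
Qed.

(** The constants contribute [ln B/ln r] and [ln b/ln r], which are negligible for large [r]. A
    lower bound at arbitrarily large [r] suffices for an upper limit. *)
Lemma limf_esup_half (T : R -> \bar R) (B b : R) : 0 < B -> 0 < b ->
  (forall r, 1 <= r -> (0 <= T r <= (B * Num.sqrt r)%:E)%E) ->
  (forall M, exists2 r, M < r & ((b * Num.sqrt r)%:E <= T r)%E) ->
  limf_esup (fun r : R => lne (T r) / (ln r)%:E)%E +oo%R = (2^-1)%:E.
Proof.
move=> B0 b0 Tle Tge.
have divE (x : \bar R) (r : R) : 1 < r -> (x / (ln r)%:E = x * ((ln r)^-1)%:E)%E.
  by move=> r1; rewrite inver gt_eqF // ln_gt0.
apply/eqP; rewrite eq_le; apply/andP; split.
  apply/lee_addgt0Pr => e e0.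
  pose M := Num.max 1 (expR (ln B / e)).
  pose V : set R := [set r | M < r].
  pose g := (fun r : R => lne (T r) / (ln r)%:E)%E.
  apply: le_trans (_ : ereal_sup (g @` V) <= _)%E.
    apply: ereal_inf_lbound; exists V => //.
    by exists M; split; [exact: num_real|].
  apply: ge_ereal_sup => _ [r /= Mr <-].
  have r1 : 1 < r by apply: le_lt_trans Mr; rewrite le_max lexx.
  have r0 : 0 < r := lt_trans ltr01 r1.
  have rB : ln B / e <= ln r.
    by apply: ln_ge_of_gt_expR; apply: le_lt_trans Mr; rewrite le_max lexx orbT.
  have l0 : 0 < ln r by rewrite ln_gt0.
  rewrite /g divE // lee_pdivrMr // -EFinD -EFinM.
  have /andP[T0 TB] := Tle r (ltW r1).
  have Bs : 0 < B * Num.sqrt r by rewrite mulr_gt0 // sqrtr_gt0.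
  apply: le_trans (_ : lne (B * Num.sqrt r)%:E <= _)%E.
    by rewrite lee_lne // in_itv /= ?T0 ?leey ?lee_fin ?(ltW Bs).
  rewrite lne_EFin // ln_mul_sqrt // lee_fin mulrDl addrC (mulrC (ln r)) lerD2l.
  by rewrite mulrC -ler_pdivrMr.
rewrite limf_esupE; apply: le_ereal_inf_tmp => _ [V [N [_ NV]] <-].
apply/lee_subgt0Pr => e e0.
pose M := Num.max N (Num.max 1 (expR (- ln b / e))).
have [r Mr Tr] := Tge M.
have Nr : N < r by apply: le_lt_trans Mr; rewrite le_max lexx.
have r1 : 1 < r by apply: le_lt_trans Mr; rewrite /M !le_max lexx orbT.
have rb : - ln b / e <= ln r.
  by apply: ln_ge_of_gt_expR; apply: le_lt_trans Mr; rewrite /M !le_max lexx !orbT.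
have r0 : 0 < r := lt_trans ltr01 r1.
have l0 : 0 < ln r by rewrite ln_gt0.
apply: le_ereal_sup_tmp; exists (lne (T r) / (ln r)%:E)%E; first by exists r => //; exact: NV.
rewrite divE // lee_pdivlMr // -EFinB -EFinM.
have bs : 0 < b * Num.sqrt r by rewrite mulr_gt0 // sqrtr_gt0.
have T0 : (0 <= T r)%E by apply: le_trans Tr; rewrite lee_fin ltW.
apply: le_trans (_ : lne (b * Num.sqrt r)%:E <= _)%E; last first.
  by rewrite lee_lne // in_itv /= ?T0 ?leey ?lee_fin ?(ltW bs).
rewrite lne_EFin // ln_mul_sqrt // lee_fin mulrBl (mulrC _ (ln r)) addrC lerD2r.
by rewrite lerNl mulrC -ler_pdivrMr.
Qed.

Lemma solution_order y nu c d : @solution_data R y nu c d ->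
  order_of_growth (fun z : Cplx R => 1 - y (z + 1) / y z) = (2^-1)%:E.
Proof.
move=> sol; have [P HP] := proximity_fun_le sol.
have c0 := sol_c sol; have d0 := sol_d sol.
have k0 : 0 < Num.sqrt (2 / d) by rewrite sqrtr_gt0 divr_gt0.
(* At [r = 2/nu_j] with [nu_j >= d/(j+1)^2] one has [sqrt r <= sqrt(2/d) (j+1)], while
   [N(r,f) >= (j+1)/2]; this gives [b]. *)
apply: (@limf_esup_half _ (`|P| + 8 * Num.sqrt c + 1) (2 * Num.sqrt (2 / d))^-1).
- by rewrite ltr_wpDl // addr_ge0 // mulr_ge0 // sqrtr_ge0.
- by rewrite invr_gt0 mulr_gt0.
- move=> r r1; have r0 := lt_le_trans ltr01 r1.
  rewrite /nevanlinna_char; apply/andP; split.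
    by apply: adde_ge0; [exact: proximity_fun_ge0|exact: (counting_fun_ge0 sol)].
  apply: le_trans (leeD (HP r) (counting_fun_le sol r0)) _.
  rewrite -EFinD lee_fin !mulrDl mul1r.
  have s1 : 1 <= Num.sqrt r by rewrite -[leLHS]sqrtr1 ler_sqrt // ltW.
  have : P <= `|P| * Num.sqrt r.
    by apply: le_trans (ler_norm P) _; rewrite ler_peMr.
  lra.
- move=> M; have [J hJ] := nu_small sol (normr_ge0 M).
  have [j Jj dj] := sol_large sol J.
  have nj : 0 < nu j by apply: lt_le_trans dj; rewrite divr_gt0 ?exprn_gt0.
  have r0 : 0 < 2 / nu j by rewrite divr_gt0.
  exists (2 / nu j).
    have := hJ _ Jj; rewrite mulrC -ltr_pdivlMr // => h.
    apply: le_lt_trans (ler_norm M) (lt_trans h _).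
    by rewrite ltr_pM2r ?invr_gt0 // ltr1n.
  apply: le_trans (_ : (j.+1%:R / 2)%:E <= _)%E; last first.
    rewrite /nevanlinna_char -[leLHS]add0e.
    by apply: leeD; [exact: proximity_fun_ge0|exact: (counting_fun_ge sol nj)].
  have kj : Num.sqrt (2 / nu j) <= Num.sqrt (2 / d) * j.+1%:R.
    rewrite -[X in _ <= _ * X](ger0_norm (ler0n R j.+1)) -sqrtr_sqr -sqrtrM; last first.
      by rewrite ltW // divr_gt0.
    rewrite ler_sqrt; last by rewrite mulr_ge0 ?sqr_ge0 // ltW // divr_gt0.
    rewrite ler_pdivrMr // -mulrA -[leLHS]mulr1 -[leRHS]mulrA.
    rewrite ler_pM2l // mulrC ler_pdivlMr // mul1r mulrC.
    by move: dj; rewrite ler_pdivrMr ?exprn_gt0.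
  rewrite lee_fin invfM -mulrA mulrC ler_pM2r ?invr_gt0 //.
  by rewrite ler_pdivrMl.
Qed.

Lemma rational_inv_shift :
  @rational_fun R (fun z => - 1 / (z + 2)).
Proof.
exists (- 1)%:P, ('X + 2%:P); split; first by rewrite -size_poly_gt0 size_XaddC.
by move=> z0; near=> z; rewrite hornerD hornerX !hornerC.
Unshelve. all: by end_near. Qed.

End OrderOneHalf.

Local Close Scope classical_set_scope.

Theorem proposition6p1 (R : realType) :
  exists A f : Cplx R -> Cplx R,
    [/\ rational_fun A, meromorphic f, transcendental f,
        order_of_growth f = (2^-1)%:E
      & meq (fun z => f (z + 1)) (fun z => (f z + A z) / (1 - f z))].
Proof.
have [y [nu [c [d sol]]]] := exists_solution R.
exists (fun z => - 1 / (z + 2)), (fun z => 1 - y (z + 1) / y z); split.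
- exact: rational_inv_shift.
- exact: (f_meromorphic sol).
- exact: (f_transcendental sol).
- exact: (solution_order sol).
- exact: (f_riccati sol).
Qed.
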